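(* Let $\varepsilon_1,\varepsilon_2>0$ and let $x(t)\in\mathcal D_{\varepsilon_1,\varepsilon_2}$, with window $g$, threshold $\tau_0$, number $\alpha$ and window-width function $\sigma(t)$ as in the context. Fix $t\in\mathbb R$ and let $\tilde\epsilon_1=\tilde\epsilon_1(t)>0$. Then the following hold. (a) Suppose $\tilde\epsilon_1\ge \sigma(t)\Lambda_0(t)+\tau_0\sum_{k=1}^K A_k(t)$. Then for every $\eta$ with $|\tilde V_x(t,\eta)|>\tilde\epsilon_1$ there exists $k\in\{1,\dots,K\}$ such that $(t,\eta)\in Z_k$. (b) For $(t,\eta)$ with $\tilde V_x(t,\eta)\neq 0$ and every $k\in\{1,\dots,K\}$, $$\omega_x^{adp,c}(t,\eta)-\phi_k'(t)=\frac{\mathrm{Rem}_1}{i2\pi \tilde V_x(t,\eta)},$$ where $$\mathrm{Rem}_1=i2\pi\big(\eta-\phi_k'(t)\big)\mathrm{rem}_0-\frac{\mathrm{rem}_0'}{\sigma(t)}+i2\pi\sum_{\ell\ne k}x_\ell(t)\big(\phi_\ell'(t)-\phi_k'(t)\big)\hat g\big(\sigma(t)(\eta-\phi_\ell'(t))\big).$$ Hence, for $(t,\eta)$ satisfying $|\tilde V_x(t,\eta)|>\tilde\epsilon_1$ and $(t,\eta)\in Z_k$, $$|\omega_x^{adp}(t,\eta)-\phi_k'(t)|<\mathrm{bd}_1,$$ where $$\mathrm{bd}_1=\frac1{\tilde\epsilon_1}\Big(\alpha\Lambda_0(t)+\frac1{2\pi}\tilde\Lambda_0(t)\Big)+\frac1{\tilde\epsilon_1}\max_{k\in\{1,\dots,K\}}\Big\{\sum_{\ell\neq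 k}A_\ell(t)\,|\phi_\ell'(t)-\phi_k'(t)|\sup_{|u|<\alpha}\big|\hat g\big(u+\sigma(t)(\phi_k'(t)-\phi_\ell'(t))\big)\big|\Big\}.$$ (c) Suppose that $\tilde\epsilon_1$ satisfies the condition $\tilde\epsilon_1\ge \sigma(t)\Lambda_0(t)+\tau_0\sum_{k=1}^K A_k(t)$ and that $\mathrm{bd}_1\le \alpha/\sigma(t)$. Then for every $\tilde\epsilon_3$ with $\mathrm{bd}_1\le\tilde\epsilon_3\le \alpha/\sigma(t)$ and every $k\in\{1,\dots,K\}$, $$\Big|\lim_{\lambda\to0}\frac{\sigma(t)}{g(0)}\int_{|\xi-\phi_k'(t)|<\tilde\epsilon_3}R^{adp,\lambda}_{x,\tilde\epsilon_1}(t,\xi)\,d\xi-x_k(t)\Big|\le\mathrm{bd}_2,$$ where $$\mathrm{bd}_2=\frac1{|g(0)|}\Big\{2\alpha\big(\sigma(t)\Lambda_0(t)+\tilde\epsilon_1\big)+A_k(t)\Big|\int_{|u|\ge\alpha}\hat g(u)\,du\Big|+\sum_{\ell\ne k}A_\ell(t)m_{\ell,k}(t)\Big\},$$ $$m_{\ell,k}(t)=\Big|\int_{|u|\le\alpha}\hat g\big(u+\sigma(t)(\phi_k'(t)-\phi_\ell'(t))\big)du\Big|.$$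
   Context: Fourier transform: $\hat f(\xi)=\int_{\mathbb R}f(t)e^{-i2\pi\xi t}dt$. The notation $\sum_{\ell\ne k}$ means the sum over $\ell\in\{1,\dots,K\}\setminus\{k\}$. Signal class. $\mathcal D_{\varepsilon_1,\varepsilon_2}$ is the set of signals $x(t)=\sum_{k=1}^Kx_k(t)$, $x_k(t)=A_k(t)e^{i2\pi\phi_k(t)}$, such that for all $1\le k\le K$: $A_k\in C^1(\mathbb R)\cap L_\infty(\mathbb R)$, $\phi_k\in C^2(\mathbb R)$ (real-valued), $A_k(t)>0$ for all $t$, $\inf_{t}\phi_k'(t)>0$, $\sup_t\phi_k'(t)<\infty$; $|A_k'(t)|\le\varepsilon_1$ and $|\phi_k''(t)|\le\varepsilon_2$ for all $t\in\mathbb R$; and $\min_{2\le k\le K}\inf_{t\in\mathbb R}(\phi_k'(t)-\phi_{k-1}'(t))>0$. Window. $g$ is in the Schwartz class, $g(0)\neq0$, $|\hat g(\xi)|$ is even and decreasing for $\xi\ge0$. $0<\tau_0<1$ is a threshold and $\alpha>0$ satisfies $|\hat g(\alpha)|=\tau_0$. (When $\hat g$ is supported in $[-\alpha,\alpha]$, one may take $\tau_0=0$.) $\sigma:\mathbb R\to(0,\infty)$ is a $C^1$ function satisfying $\sigma(t)\ge \dfrac{2\alpha}{\phi_k'(t)-\phi_{k-1}'(t)}$ for all $t\in\mathbb R$, $k=2,\dots,K$. Time-frequency zones: $Z_k=\{(t,\eta):|\eta-\phi_k'(t)|<\alpha/\sigma(t),\ t\in\mathbb R\}$. Adaptive STFT: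 for a function $f$ in the Schwartz class, $$\tilde V_x^{f}(t,\eta)=\int_{\mathbb R}x(t+\tau)\frac1{\sigma(t)}f\Big(\frac{\tau}{\sigma(t)}\Big)e^{-i2\pi\eta\tau}d\tau,$$ and $\tilde V_x=\tilde V_x^{g}$. Let $g_3(\tau)=\tau g'(\tau)$. Phase transformation: where $\tilde V_x(t,\eta)\ne0$, $$\omega_x^{adp,c}(t,\eta)=\frac{\partial_t\tilde V_x(t,\eta)}{i2\pi\tilde V_x(t,\eta)}+\frac{\sigma'(t)}{i2\pi\sigma(t)}+\frac{\sigma'(t)}{\sigma(t)}\frac{\tilde V_x^{g_3}(t,\eta)}{i2\pi\tilde V_x(t,\eta)},\qquad \omega_x^{adp}=\mathrm{Re}\,\omega_x^{adp,c}.$$ Adaptive FSST: for $\gamma>0,\lambda>0$, $$R^{adp,\lambda}_{x,\gamma}(t,\xi)=\int_{\{\eta:\,|\tilde V_x(t,\eta)|>\gamma\}}\tilde V_x(t,\eta)\frac1\lambda h\Big(\frac{\xi-\omega_x^{adp}(t,\eta)}{\lambda}\Big)d\eta,$$ where $h$ is a fixed compactly supported smooth function with $\int_{\mathbb R}h(t)dt=1$; $\lambda\to0$ means $\lambda\to0^+$. Remainders: $$\mathrm{rem}_0=\sum_{k=1}^K\int_{\mathbb R}\Big\{(A_k(t+\tau)-A_k(t))e^{i2\pi\phi_k(t+\tau)}+x_k(t)e^{i2\pi\phi_k'(t)\tau}\big(e^{i2\pi(\phi_k(t+\tau)-\phi_k(t)-\phi_k'(t)\tau)}-1\big)\Big\}\frac1{\sigma(t)}g\Big(\frac\tau{\sigma(t)}\Big)e^{-i2\pi\eta\tau}d\tau,$$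 a function of $(t,\eta)$, and $\mathrm{rem}_0'$ is the same expression with $g$ replaced by the derivative $g'$. Constants: $I_n=\int_{\mathbb R}|\tau^ng(\tau)|d\tau$, $\tilde I_n=\int_{\mathbb R}|\tau^ng'(\tau)|d\tau$, $$\Lambda_0(t)=K\varepsilon_1I_1+\pi\varepsilon_2I_2\sigma(t)\sum_{k=1}^KA_k(t),\qquad \tilde\Lambda_0(t)=K\varepsilon_1\tilde I_1+\pi\varepsilon_2\tilde I_2\sigma(t)\sum_{k=1}^KA_k(t).$$ *)

(* Defs.v *)
From HB Require Import structures.
From mathcomp Require Import all_boot all_order all_algebra.
From mathcomp Require Import all_classical all_reals all_analysis.
From mathcomp Require Export complex.

Set Implicit Arguments.
Unset Strict Implicit.
Unset Printing Implicit Defensive.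

Import Order.TTheory GRing.Theory Num.Theory.
Import numFieldNormedType.Exports.

Local Open Scope classical_set_scope.
Local Open Scope ring_scope.

Section ComplexValued.
Variable R : realType.
Implicit Types (f g : R -> R[i]) (D : set R).

Definition cmod (z : R[i]) : R := Normc.normc z.

Definition cis (theta : R) : R[i] := (cos theta +i* sin theta)%C.

Definition i2pi : R[i] := (0 +i* (2 * pi))%C.

(* Calculus for functions of a real variable with complex values is done on
   real and imaginary parts, since R[i] is not a normed space over R in the
   library.  As usual for total operators, cderive and cintegral are only
   meaningful on differentiable, resp. integrable, functions. *)
Definition cderivable f t : Prop :=
  derivable (fun s => complex.Re (f s)) t 1 /\
  derivable (fun s => complex.Im (f s)) t 1.

Definition cderive f t : R[i] :=
  (derive1 (fun s => complex.Re (f s)) t +i*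
   derive1 (fun s => complex.Im (f s)) t)%C.

Definition cintegral D f : R[i] :=
  ((\int[lebesgue_measure]_(x in D) complex.Re (f x)) +i*
   (\int[lebesgue_measure]_(x in D) complex.Im (f x)))%C.

Definition smooth f : Prop := forall n t, cderivable (iter n cderive f) t.

Definition schwartz f : Prop :=
  smooth f /\
  forall m n : nat, exists M : R, forall t : R,
    cmod ((t ^+ m)%:C%C * iter n cderive f t) <= M.

Definition csupport f : set R := closure [set t | f t != 0].

Definition fourier f (xi : R) : R[i] :=
  cintegral setT (fun t => f t * cis (- (2 * pi * xi * t))).

Definition class_C (n : nat) (f : R -> R) : Prop :=
  (forall j t, (j < n)%N -> derivable (derive1n j f) t 1) /\
  continuous (derive1n n f).

End ComplexValued.

Section Signals.
Variables (R : realType) (K : nat) (A phi : 'I_K -> R -> R).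

Definition component (k : 'I_K) (t : R) : R[i] :=
  (A k t)%:C%C * cis (2 * pi * phi k t).

Definition signal (t : R) : R[i] := \sum_(k < K) component k t.

(* The infima and suprema are taken in the extended reals, so no boundedness
   is presupposed; on the last line the minimum over consecutive indices is
   positive iff each term is, and the condition is void for K = 1. *)
Record signal_class (eps1 eps2 : R) : Prop := SignalClass {
  amp_C1 : forall k, class_C 1 (A k);
  amp_Loo : forall k, ('N[lebesgue_measure]_+oo [EFin \o A k] < +oo)%E;
  phase_C2 : forall k, class_C 2 (phi k);
  amp_gt0 : forall k t, 0 < A k t;
  freq_inf : forall k,
    (0 < ereal_inf (range (fun t => (derive1 (phi k) t)%:E)))%E;
  freq_sup : forall k,
    (ereal_sup (range (fun t => (derive1 (phi k) t)%:E)) < +oo)%E;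
  amp_slow : forall k t, `|derive1 (A k) t| <= eps1;
  freq_slow : forall k t, `|derive1n 2 (phi k) t| <= eps2;
  freq_sep : forall j k : 'I_K, k = j.+1 :> nat ->
    (0 < ereal_inf (range (fun t =>
           (derive1 (phi k) t - derive1 (phi j) t)%:E)))%E
}.

(* "Decreasing" is in the wide sense, which compactly supported Fourier
   transforms require.  The threshold tau0 = 0 is admitted only when the
   Fourier transform of g is supported in [- alpha, alpha]. *)
Record window (g : R -> R[i]) (tau0 alpha : R) : Prop := Window {
  window_schwartz : schwartz g;
  window_neq0 : g 0 != 0;
  window_even : forall xi, cmod (fourier g (- xi)) = cmod (fourier g xi);
  window_decr : forall xi1 xi2, 0 <= xi1 -> xi1 <= xi2 ->
    cmod (fourier g xi2) <= cmod (fourier g xi1);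
  window_tau0 : 0 < tau0 < 1 \/
    tau0 = 0 /\ csupport (fourier g) `<=` `[- alpha, alpha];
  window_alpha_gt0 : 0 < alpha;
  window_alpha : cmod (fourier g alpha) = tau0
}.

Record window_width (alpha : R) (sigma : R -> R) : Prop := WindowWidth {
  width_C1 : class_C 1 sigma;
  width_gt0 : forall t, 0 < sigma t;
  width_sep : forall (j k : 'I_K) t, k = j.+1 :> nat ->
    2 * alpha / (derive1 (phi k) t - derive1 (phi j) t) <= sigma t
}.

Definition zone (alpha : R) (sigma : R -> R) (k : 'I_K) : set (R * R) :=
  [set p | `|p.2 - derive1 (phi k) p.1| < alpha / sigma p.1].

(* Remainder with window f: rem_0 for f = g and rem_0' for f = g'. *)
Definition remainder (sigma : R -> R) (f : R -> R[i]) (t eta : R) : R[i] :=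
  \sum_(k < K) cintegral setT (fun tau =>
    ((A k (t + tau) - A k t)%:C%C * cis (2 * pi * phi k (t + tau))
     + component k t * cis (2 * pi * derive1 (phi k) t * tau)
       * (cis (2 * pi * (phi k (t + tau) - phi k t - derive1 (phi k) t * tau))
          - 1))
    * ((sigma t)^-1)%:C%C * f (tau / sigma t) * cis (- (2 * pi * eta * tau))).

(* The moment int |tau^n f(tau)| dtau: I_n for f = g, tilde I_n for f = g'. *)
Definition moment (n : nat) (f : R -> R[i]) : R :=
  \int[lebesgue_measure]_(tau in setT) cmod ((tau ^+ n)%:C%C * f tau).

(* Lambda_0 for f = g, tilde Lambda_0 for f = g'. *)
Definition Lambda (eps1 eps2 : R) (sigma : R -> R) (f : R -> R[i]) (t : R) : R :=
  K%:R * eps1 * moment 1 f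
  + pi * eps2 * moment 2 f * sigma t * \sum_(k < K) A k t.

(* The terms of the maximum are nonnegative, so the default value 0 of the
   big operator is harmless. *)
Definition bd1 (eps1 eps2 alpha : R) (sigma : R -> R) (g : R -> R[i])
    (t te1 : R) : R :=
  te1^-1 * (alpha * Lambda eps1 eps2 sigma g t
            + (2 * pi)^-1 * Lambda eps1 eps2 sigma (cderive g) t)
  + te1^-1 * \big[Num.max/0]_(k < K) \sum_(l < K | l != k)
      A l t * `|derive1 (phi l) t - derive1 (phi k) t|
      * sup [set cmod (fourier g
                   (u + sigma t * (derive1 (phi k) t - derive1 (phi l) t)))
            | u in [set u : R | `|u| < alpha]].

Definition leakage (alpha : R) (sigma : R -> R) (g : R -> R[i])
    (l k : 'I_K) (t : R) : R :=
  cmod (cintegral [set u : R | `|u| <= alpha] (fun u =>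
    fourier g (u + sigma t * (derive1 (phi k) t - derive1 (phi l) t)))).

Definition bd2 (eps1 eps2 alpha : R) (sigma : R -> R) (g : R -> R[i])
    (t te1 : R) (k : 'I_K) : R :=
  (cmod (g 0))^-1 *
  (2 * alpha * (sigma t * Lambda eps1 eps2 sigma g t + te1)
   + A k t * cmod (cintegral [set u : R | alpha <= `|u|] (fourier g))
   + \sum_(l < K | l != k) A l t * leakage alpha sigma g l k t).

End Signals.

Section AdaptiveTransforms.
Variables (R : realType) (x : R -> R[i]) (sigma : R -> R).

Definition stft (f : R -> R[i]) (t eta : R) : R[i] :=
  cintegral setT (fun tau =>
    x (t + tau) * ((sigma t)^-1)%:C%C * f (tau / sigma t)
    * cis (- (2 * pi * eta * tau))).

Definition window3 (g : R -> R[i]) (tau : R) : R[i] := tau%:C%C * cderive g tau.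

(* Only meaningful where stft g t eta != 0. *)
Definition phase_transform_c (g : R -> R[i]) (t eta : R) : R[i] :=
  cderive (fun s => stft g s eta) t / (i2pi R * stft g t eta)
  + (derive1 sigma t)%:C%C / (i2pi R * (sigma t)%:C%C)
  + (derive1 sigma t / sigma t)%:C%C
    * (stft (window3 g) t eta / (i2pi R * stft g t eta)).

Definition phase_transform (g : R -> R[i]) (t eta : R) : R :=
  complex.Re (phase_transform_c g t eta).

Definition fsst (g h : R -> R[i]) (gamma lambda t xi : R) : R[i] :=
  cintegral [set eta : R | gamma < cmod (stft g t eta)] (fun eta =>
    stft g t eta * (lambda^-1)%:C%C
    * h ((xi - phase_transform g t eta) / lambda)).

End AdaptiveTransforms.

(* Main.v *)
(** Write each component near [t] as a pure tone of frequency [phi_k'(t)] plus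
    a remainder.  Then [V^f(t, eta)] is the sum of the
    [x_k(t) f^(sigma (eta - phi_k'(t)))] and a remainder of size at most
    [sigma Lambda], which gives (a) by monotonicity of [|g^|].  After the shift
    [r = t + tau] the time dependence of [V] sits in the window only, and
    differentiation under the integral gives
    [omega^c = eta - V^{g'} / (2 i pi sigma V)]; inserting both decompositions
    together with [(g')^ = 2 i pi xi g^] gives (b).  For (c), Fubini moves the
    integral over [xi] onto the mollifier, whose mass in [|xi - phi_k'| < te3]
    tends to 1 or 0 according to whether [omega] is within [te3] of
    [phi_k'].  By (a), (b) and the separation of the frequencies this happens
    exactly on the zone [Z_k], so dominated convergence yields the integral of
    [V] over [Z_k] intersected with [|V| > te1].  It is compared with
    [x_k(t) g(0) / sigma] through the inversion formula [int g^ = g(0)], itself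
    obtained by Poisson regularization. *)
Require Import Defs.
From mathcomp Require Import all_boot all_order all_algebra.
From mathcomp Require Import all_classical all_reals all_analysis.
From mathcomp Require Import measurable_realfun ring lra.
Import Order.TTheory GRing.Theory Num.Theory.
Import numFieldNormedType.Exports.
Local Open Scope classical_set_scope.
Local Open Scope ring_scope.

Set Implicit Arguments.
Unset Strict Implicit.
Unset Printing Implicit Defensive.

(** The estimates let the signal grow like [1 + r^2], so windows carry the decay [(1 + u^2)^-2]: one
    power absorbs the growth or a moment weight, the other keeps integrals convergent, even after
    differentiation in time, where the majorant must be uniform for [s] near [t]. Strict
    inequalities matter. The numerator bound in (b) is only [<=]; it becomes strict through
    [te1 < |V|] once the bound is positive, which rests on [I_1 > 0], a consequence of [g 0 != 0].
    In (c) strictness leaves a gap between [|omega - phi_k'|] and [te3] on either side; as [h] has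
    compact support, the mass of the mollifier is then, for each frequency, eventually equal to 1 or
    to 0, and no boundary case survives in the limit. The hypothesis of (a) serves (c) a second
    time: it confines the set [|V| > te1] to a bounded set, which gives Fubini and dominated
    convergence integrable majorants. For the inversion formula the damping factor is [e^{-|x|}],
    because its transform [2 / (1 + (2 pi xi)^2)] follows from one elementary antiderivative. *)

Section Lipschitz.
Variable R : realType.

Lemma le_lipschitz (f : R -> R) (M : R) : (forall x, derivable f x 1) ->
  (forall x, `|derive1 f x| <= M) -> forall a b, `|f b - f a| <= M * `|b - a|.
Proof.
move=> df dM.
have aux a b : a < b -> `|f b - f a| <= M * `|b - a|.
  move=> ab; have [| |c _] := @MVT _ f (derive1 f) a b ab.
  - by move=> x _; rewrite derive1E; apply: DeriveDef.
  - by apply: derivable_within_continuous => x _; exact: df.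
  - by move=> ->; rewrite normrM ler_wpM2r.
move=> a b; have [/aux//|/aux|->] := ltgtP a b.
  by rewrite distrC (distrC a).
by rewrite !subrr !normr0 mulr0.
Qed.

End Lipschitz.

(** * Modulus of complex numbers and the unit circle *)

Section Cmod.
Variable R : realType.
Implicit Types (z w : R[i]) (a b : R).
Local Notation Re := (@complex.Re R).
Local Notation Im := (@complex.Im R).

Lemma ReD z w : Re (z + w) = Re z + Re w. Proof. by case: z w => ? ? []. Qed.
Lemma ImD z w : Im (z + w) = Im z + Im w. Proof. by case: z w => ? ? []. Qed.
Lemma ReN z : Re (- z) = - Re z. Proof. by case: z. Qed.
Lemma ImN z : Im (- z) = - Im z. Proof. by case: z. Qed.
Lemma ReM z w : Re (z * w) = Re z * Re w - Im z * Im w.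
Proof. by case: z w => ? ? []. Qed.
Lemma ImM z w : Im (z * w) = Re z * Im w + Im z * Re w.
Proof. by case: z w => ? ? []. Qed.

Lemma cmodE z : cmod z = Num.sqrt (Re z ^+ 2 + Im z ^+ 2).
Proof. by case: z. Qed.
Lemma cmodM z w : cmod (z * w) = cmod z * cmod w.
Proof. exact: Normc.normcM. Qed.
Lemma cmodV z : cmod z^-1 = (cmod z)^-1.
Proof. exact: Normc.normcV. Qed.
Lemma cmodD z w : cmod (z + w) <= cmod z + cmod w.
Proof. exact: le_normcD. Qed.
Lemma cmodN z : cmod (- z) = cmod z.
Proof. exact: normcN. Qed.
Lemma cmod_ge0 z : 0 <= cmod z.
Proof. by rewrite cmodE sqrtr_ge0. Qed.
Lemma cmod0 : cmod (0 : R[i]) = 0.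
Proof. exact: Normc.normc0. Qed.
Lemma cmod_eq0 z : (cmod z == 0) = (z == 0).
Proof. by apply/eqP/eqP => [/Normc.eq0_normc|->]; rewrite ?cmod0. Qed.
Lemma cmod_gt0 z : (0 < cmod z) = (z != 0).
Proof. by rewrite lt_neqAle cmod_ge0 andbT eq_sym cmod_eq0. Qed.
Lemma cmodr a : cmod a%:C%C = `|a|.
Proof. by rewrite cmodE /= expr0n /= addr0 sqrtr_sqr. Qed.
Lemma cmod_cis a : cmod (cis a) = 1.
Proof. by rewrite cmodE /= cos2Dsin2 sqrtr1. Qed.
Lemma cmod_sqr z : cmod z ^+ 2 = Re z ^+ 2 + Im z ^+ 2.
Proof. by rewrite cmodE sqr_sqrtr// addr_ge0// sqr_ge0. Qed.
Lemma Re_le_cmod z : `|Re z| <= cmod z.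
Proof. by rewrite cmodE -sqrtr_sqr ler_wsqrtr// lerDl sqr_ge0. Qed.
Lemma Im_le_cmod z : `|Im z| <= cmod z.
Proof. by rewrite cmodE -sqrtr_sqr ler_wsqrtr// lerDr sqr_ge0. Qed.
Lemma cmod_le_ReIm z : cmod z <= `|Re z| + `|Im z|.
Proof.
rewrite cmodE -[leRHS]ger0_norm ?addr_ge0// -sqrtr_sqr ler_wsqrtr//.
rewrite sqrrD !real_normK ?num_real//.
by rewrite -addrA lerD2l lerDr mulrn_wge0// mulr_ge0.
Qed.
Lemma cmod_sum I (s : seq I) (P : pred I) (F : I -> R[i]) :
  cmod (\sum_(i <- s | P i) F i) <= \sum_(i <- s | P i) cmod (F i).
Proof.
elim/big_rec2: _ => [|i y x _ le]; first by rewrite cmod0.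
by rewrite (le_trans (cmodD _ _))// lerD2l.
Qed.
Lemma cmod_i2pi : cmod (i2pi R) = 2 * pi.
Proof.
rewrite cmodE /= expr0n /= add0r sqrtr_sqr ger0_norm//.
by rewrite mulr_ge0// pi_ge0.
Qed.
Lemma i2pi_neq0 : i2pi R != 0.
Proof. by rewrite -cmod_gt0 cmod_i2pi mulr_gt0// pi_gt0. Qed.

Lemma cisD a b : cis (a + b) = cis a * cis b.
Proof.
by apply/eqP; rewrite eq_complex ReM ImM /= cosD sinD eqxx /= addrC.
Qed.
Lemma cis0 : cis 0 = 1 :> R[i].
Proof. by rewrite /cis cos0 sin0. Qed.

Lemma normr_sin_le (a : R) : `|sin a| <= `|a|.
Proof.
suff : `|sin a - sin 0| <= 1 * `|a - 0| by rewrite sin0 !subr0 mul1r.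
apply: le_lipschitz => x; first exact: ex_derive.
by rewrite derive1E derive_val cos_max.
Qed.

(** A chord is no longer than its arc: the half-angle formulas give the chord the length
    [2 |sin (a / 2)|]. Later this turns the phase error of a component into a bound quadratic in
    time. *)
Lemma cis_sub1_le a : cmod (cis a - 1) <= `|a|.
Proof.
have -> : cmod (cis a - 1) = 2 * `|sin (a / 2)|.
  rewrite cmodE -[RHS]ger0_norm ?mulr_ge0// -sqrtr_sqr exprMn real_normK ?num_real//.
  congr Num.sqrt; rewrite ReD ImD ReN ImN /=.
  have -> : a = a / 2 + a / 2 by lra.
  have := cos2Dsin2 (a / 2); rewrite cosD sinD.
  have -> : (a / 2 + a / 2) / 2 = a / 2 by lra.
  set c := cos _; set s := sin _ => h.
  have hc : c ^+ 2 = 1 - s ^+ 2 by apply: (canRL (addrK _)).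
  have -> : c * c - s * s - 1 = - (2 * s ^+ 2) by rewrite -expr2 hc; ring.
  have -> : 2 ^+ 2 * s ^+ 2 = (2 * s ^+ 2) ^+ 2 + 4 * s ^+ 2 * (1 - s ^+ 2) by ring.
  rewrite -hc; ring.
by have := normr_sin_le (a / 2); rewrite normrM [`|2^-1|]ger0_norm//; lra.
Qed.

End Cmod.

Lemma oneDsqr_gt0 (R : realType) (x : R) : 0 < oneDsqr x.
Proof. exact: lt_le_trans ltr01 (oneDsqr_ge1 x). Qed.

(** * Affine changes of variable and an integrable reference function *)

Section Affine.
Variable R : realType.
Local Notation mu := (@lebesgue_measure R).

(** By uniqueness of Lebesgue measure: [a] times the pushforward assigns its length to every
    half-open interval. *)
Lemma pushforward_affine (a b : R) (A : set R) : 0 < a -> measurable A ->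
  (pushforward mu (fun x : measurableTypeR R => (a * x + b)%R : measurableTypeR R) A
   = (a^-1)%:E * mu A)%E.
Proof.
move=> a0 mA.
have mphi : measurable_fun setT (fun x : measurableTypeR R => (a * x + b)%R : measurableTypeR R).
  by apply: measurable_funD => //; exact: measurable_funM.
have ai0 : (0 <= a)%R by exact: ltW.
pose k : {nonneg R} := NngNum ai0.
pose m := mscale k (pushforward mu (fun x : measurableTypeR R => (a * x + b)%R : measurableTypeR R)).
have : mu A = m mphi A.
  apply: lebesgue_measure_unique => //= _ [[c d]] _ <-.
  rewrite /mscale /= /pushforward.
  have -> : (fun x : R => a * x + b)%R @^-1` `]c, d]%classic = `]((c - b) / a)%R, ((d - b) / a)%R]%classic.
    apply/seteqP; split => x /=; rewrite !in_itv /= ltr_pdivrMr// ler_pdivlMr//;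
    by rewrite ltrBlDr lerBrDr mulrC.
  rewrite !lebesgue_measure_itv /= !lte_fin ltr_pM2r ?invr_gt0// ltrD2r.
  case: ifP => _; last by rewrite mule0.
  rewrite -!EFinD -EFinM; congr EFin; field.
  by rewrite gt_eqF.
rewrite /m /mscale /= => ->.
by rewrite muleA -EFinM mulVf ?gt_eqF// mul1e.
Qed.

Lemma ge0_integral_affine (a b : R) (f : R -> \bar R) : 0 < a ->
  measurable_fun setT f -> (forall x, (0 <= f x)%E) ->
  (\int[mu]_x f (a * x + b)%R = (a^-1)%:E * \int[mu]_x f x)%E.
Proof.
move=> a0 mf f0.
have mphi : measurable_fun setT (fun x : measurableTypeR R => (a * x + b)%R : measurableTypeR R).
  by apply: measurable_funD => //; exact: measurable_funM.
have := @ge0_integral_pushforward _ _ _ _ R _ mphi mu setT f measurableT mf (fun x _ => f0 x).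
rewrite preimage_setT => <-.
have ai0 : (0 <= a^-1)%R by rewrite invr_ge0 ltW.
rewrite -[(a^-1)%:E]/((NngNum ai0)%:num%:E) -ge0_integral_mscale//.
by apply: eq_measure_integral => A mA _; exact: pushforward_affine.
Qed.

Lemma integrable_affine (a b : R) (f : R -> R) : 0 < a ->
  mu.-integrable setT (EFin \o f) ->
  mu.-integrable setT (EFin \o (fun x => f (a * x + b))).
Proof.
move=> a0 /integrableP[/measurable_EFinP mf foo]; apply/integrableP; split.
  apply/measurable_EFinP; apply: measurableT_comp mf _.
  by apply: measurable_funD => //; exact: measurable_funM.
have := @ge0_integral_affine a b (fun x => `|(f x)%:E|%E) a0 _ (fun=> abse_ge0 _).
move=> /= ->; last by do 2 apply: measurableT_comp => //.
have ai : (0 <= a^-1%:E)%E by rewrite lee_fin invr_ge0 ltW.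
by rewrite lte_mul_pinfty.
Qed.

Lemma Rintegral_affine (a b : R) (f : R -> R) : 0 < a ->
  mu.-integrable setT (EFin \o f) ->
  \int[mu]_x f (a * x + b) = a^-1 * \int[mu]_x f x.
Proof.
move=> a0 intf; have /integrableP[mf foo] := intf.
rewrite /Rintegral -[a^-1]/(fine (a^-1)%:E) -fineM//; last exact: integrable_fin_num.
congr fine; rewrite [in RHS]integralE muleBr//; last first.
  by apply: fin_num_adde_defl; rewrite fin_numN; exact: integrable_neg_fin_num intf.
rewrite integralE; congr (_ - _)%E.
  rewrite -(@ge0_integral_affine a b)//; last exact: measurable_funepos.
  by apply: eq_integral => x _; rewrite !funeposE.
rewrite -(@ge0_integral_affine a b)//; last exact: measurable_funeneg.
by apply: eq_integral => x _; rewrite !funenegE.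
Qed.

Lemma ge0_integralN (f : R -> \bar R) :
  measurable_fun setT f -> (forall x, (0 <= f x)%E) ->
  (\int[mu]_x f (- x)%R = \int[mu]_x f x)%E.
Proof.
move=> mf f0.
have mphi : measurable_fun setT (-%R : measurableTypeR R -> measurableTypeR R).
  exact: oppr_measurable.
have := @ge0_integral_pushforward _ _ _ _ R _ mphi mu setT f measurableT mf (fun x _ => f0 x).
rewrite preimage_setT => <-.
by apply: eq_measure_integral => A mA _; exact: lebesgue_measureN.
Qed.

Lemma RintegralNx (f : R -> R) : mu.-integrable setT (EFin \o f) ->
  \int[mu]_x f (- x) = \int[mu]_x f x.
Proof.
move=> intf; have /integrableP[mf foo] := intf.
rewrite /Rintegral; congr fine.
rewrite integralE [in RHS]integralE; congr (_ - _)%E.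
  rewrite -[RHS]ge0_integralN//; last exact: measurable_funepos.
  by apply: eq_integral => x _; rewrite !funeposE.
rewrite -[RHS]ge0_integralN//; last exact: measurable_funeneg.
by apply: eq_integral => x _; rewrite !funenegE.
Qed.

(** This function is the majorant behind most integrability proofs below. Evenness reduces the claim
    to the half-line, where the integral is known from the arctangent. *)
Lemma integrable_oneDsqrV : mu.-integrable setT (EFin \o (fun x : R => (oneDsqr x)^-1)).
Proof.
apply/integrableP; split.
  by apply/measurable_EFinP; apply: continuous_measurable_fun; exact: continuous_oneDsqrV.
under eq_integral do rewrite /= ger0_norm ?invr_ge0 ?oneDsqr_ge0//.
rewrite ge0_symfun_integralT//=.
- rewrite (_ : [set x | _] = `[0, +oo[%classic); last first.
    by apply/seteqP; split => x /=; rewrite in_itv/= andbT.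
  by rewrite integral0y_oneDsqr -EFinM ltry.
- exact: continuous_oneDsqrV.
- by move=> x; rewrite /= /oneDsqr sqrrN.
Qed.

Lemma integrable_dom (f G : R -> R) : measurable_fun setT f ->
  (forall x, `|f x| <= G x) -> mu.-integrable setT (EFin \o G) ->
  mu.-integrable setT (EFin \o f).
Proof.
move=> mf fG; apply: le_integrable => //; first exact/measurable_EFinP.
by move=> x _; rewrite /= lee_fin (le_trans (fG x))// ler_norm.
Qed.

Lemma integrable_oneDsqr_decay (C : R) :
  mu.-integrable setT (EFin \o (fun x : R => C / oneDsqr x)).
Proof.
by have := integrableZl measurableT C integrable_oneDsqrV.
Qed.

End Affine.

(** * Measurability and continuity of complex-valued functions *)

Section ComplexMeasurable.
Variable R : realType.
Local Notation Re := (@complex.Re R).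
Local Notation Im := (@complex.Im R).

(** The domain is an arbitrary measurable space because the integrands in Fubini's theorem live on
    the plane. *)
Definition cmeas d (T : measurableType d) (f : T -> R[i]) :=
  measurable_fun setT (fun x => Re (f x)) /\ measurable_fun setT (fun x => Im (f x)).

Definition ccont (f : R -> R[i]) :=
  continuous (fun x => Re (f x)) /\ continuous (fun x => Im (f x)).

Lemma cmeasD d (T : measurableType d) (f g : T -> R[i]) :
  cmeas f -> cmeas g -> cmeas (fun x => f x + g x).
Proof.
move=> [f1 f2] [g1 g2]; split.
  by under eq_fun do rewrite ReD; exact: measurable_funD.
by under eq_fun do rewrite ImD; exact: measurable_funD.
Qed.

Lemma cmeasM d (T : measurableType d) (f g : T -> R[i]) :
  cmeas f -> cmeas g -> cmeas (fun x => f x * g x).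
Proof.
move=> [f1 f2] [g1 g2]; split.
  by under eq_fun do rewrite ReM; apply: measurable_funB; exact: measurable_funM.
by under eq_fun do rewrite ImM; apply: measurable_funD; exact: measurable_funM.
Qed.

Lemma cmeas_cst d (T : measurableType d) (c : R[i]) : cmeas (fun _ : T => c).
Proof. by split; exact: measurable_cst. Qed.

Lemma cmeas_sum d (T : measurableType d) I (s : seq I) (P : pred I) (F : I -> T -> R[i]) :
  (forall i, P i -> cmeas (F i)) -> cmeas (fun x => \sum_(i <- s | P i) F i x).
Proof.
move=> mF; elim: s => [|i s IH].
  rewrite (_ : (fun x => _) = (fun=> 0)); first exact: cmeas_cst.
  by apply/funext => x; rewrite big_nil.
rewrite (_ : (fun x => _) = (fun x => if P i then F i x + \sum_(j <- s | P j) F j x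
  else \sum_(j <- s | P j) F j x)); last by apply/funext => x; rewrite big_cons.
case: (boolP (P i)) => [Pi|_]; last exact: IH.
by apply: cmeasD => //; exact: mF.
Qed.

Lemma cmeas_real d (T : measurableType d) (f : T -> R) :
  measurable_fun setT f -> cmeas (fun x => (f x)%:C%C).
Proof. by split => //=; exact: measurable_cst. Qed.

Lemma cmeas_cis d (T : measurableType d) (f : T -> R) :
  measurable_fun setT f -> cmeas (fun x => cis (f x)).
Proof.
move=> mf; split; (apply: measurableT_comp; last exact: mf);
  apply: continuous_measurable_fun; [exact: continuous_cos|exact: continuous_sin].
Qed.

Lemma cmeas_comp d (T : measurableType d) d' (T' : measurableType d')
    (f : T' -> R[i]) (h : T -> T') :
  cmeas f -> measurable_fun setT h -> cmeas (fun x => f (h x)).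
Proof. by move=> [f1 f2] mh; split; [exact: measurableT_comp f1 mh|exact: measurableT_comp f2 mh]. Qed.

Lemma cmeas_restrict d (T : measurableType d) (D : set T) (f : T -> R[i]) : measurable D ->
  cmeas f -> cmeas (fun x => (\1_D x)%:C%C * f x).
Proof. by move=> mD mf; apply: cmeasM mf; apply: cmeas_real; exact: measurable_indic. Qed.

Lemma measurable_cmod d (T : measurableType d) (f : T -> R[i]) :
  cmeas f -> measurable_fun setT (fun x => cmod (f x)).
Proof.
move=> [f1 f2]; under eq_fun do rewrite cmodE.
apply: (measurableT_comp (f := @Num.sqrt R)).
  by apply: continuous_measurable_fun; exact: sqrt_continuous.
by apply: measurable_funD; exact: measurable_funX.
Qed.

Lemma ccont_meas (f : R -> R[i]) : ccont f -> cmeas f.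
Proof. by move=> [f1 f2]; split; exact: continuous_measurable_fun. Qed.

Lemma ccontD (f g : R -> R[i]) : ccont f -> ccont g -> ccont (fun x => f x + g x).
Proof.
move=> [f1 f2] [g1 g2]; split.
  by under eq_fun do rewrite ReD; move=> x; apply: cvgD; [exact: f1|exact: g1].
by under eq_fun do rewrite ImD; move=> x; apply: cvgD; [exact: f2|exact: g2].
Qed.

Lemma ccontM (f g : R -> R[i]) : ccont f -> ccont g -> ccont (fun x => f x * g x).
Proof.
move=> [f1 f2] [g1 g2]; split.
  under eq_fun do rewrite ReM; move=> x; apply: cvgB; apply: cvgM;
  by [exact: f1|exact: g1|exact: f2|exact: g2].
under eq_fun do rewrite ImM; move=> x; apply: cvgD; apply: cvgM;
by [exact: f1|exact: g1|exact: f2|exact: g2].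
Qed.

Lemma ccont_real (f : R -> R) : continuous f -> ccont (fun x => (f x)%:C%C).
Proof. by split => //= x; exact: cvg_cst. Qed.

Lemma ccont_cst (c : R[i]) : ccont (fun=> c).
Proof. by split => x; exact: cvg_cst. Qed.

Lemma ccont_cis (f : R -> R) : continuous f -> ccont (fun x => cis (f x)).
Proof.
move=> cf; split => x.
  exact: (continuous_comp (cf x) (@continuous_cos R _)).
exact: (continuous_comp (cf x) (@continuous_sin R _)).
Qed.

Lemma ccont_comp (f : R -> R[i]) (h : R -> R) : ccont f -> continuous h ->
  ccont (fun x => f (h x)).
Proof.
move=> [f1 f2] ch; split => x; [exact: (continuous_comp (ch x) (f1 _))|exact: (continuous_comp (ch x) (f2 _))].
Qed.

Lemma continuous_cmod_sqr (f : R -> R[i]) : ccont f ->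
  continuous (fun x => Re (f x) ^+ 2 + Im (f x) ^+ 2).
Proof.
move=> [f1 f2] x; apply: cvgD; rewrite expr2; under eq_fun do rewrite expr2;
by apply: cvgM; by [exact: f1|exact: f2].
Qed.

Lemma continuous_cmod (f : R -> R[i]) : ccont f -> continuous (fun x => cmod (f x)).
Proof.
move=> cf x; under eq_fun do rewrite cmodE.
have c := continuous_cmod_sqr cf.
exact: (continuous_comp (c x) (@sqrt_continuous R _)).
Qed.

Lemma continuous_Re_div (f d : R -> R[i]) x : ccont f -> ccont d -> f x != 0 ->
  {for x, continuous (fun y => Re (d y / f y))}.
Proof.
move=> cf cd f0; have [f1 f2] := cf; have [d1 d2] := cd.
(* The real part of [d] times the conjugate of [f], over [|f|^2]: a quotient of real continuous
   functions. *)
pose p y := (Re (d y) * Re (f y) + Im (d y) * Im (f y)) / (Re (f y) ^+ 2 + Im (f y) ^+ 2).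
have -> : (fun y => Re (d y / f y)) = p.
  by apply/funext => y; rewrite /p; case: (f y) => a b; case: (d y) => a' b' /=; ring.
apply: cvgM; last first.
  apply: cvgV; last exact: continuous_cmod_sqr.
  by rewrite -cmod_sqr expf_neq0// cmod_eq0.
by apply: cvgD; apply: cvgM; by [exact: f1|exact: f2|exact: d1|exact: d2].
Qed.

End ComplexMeasurable.

(** * Calculus of the complex integral *)

Section ComplexIntegral.
Variable R : realType.
Implicit Types (f g : R -> R[i]) (c : R[i]) (a b : R).
Local Notation Re := (@complex.Re R).
Local Notation Im := (@complex.Im R).
Local Notation mu := (@lebesgue_measure R).
Local Notation intg f := (mu.-integrable setT (EFin \o f)).
Local Notation "\cint f" := (cintegral setT f) (at level 10).

Definition cintegrable f := intg (fun x => Re (f x)) /\ intg (fun x => Im (f x)).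

Lemma eq_cintegral D f g : (forall x, D x -> f x = g x) -> cintegral D f = cintegral D g.
Proof.
move=> fg; rewrite /cintegral; congr (_ +i* _)%C; apply: eq_Rintegral => x;
  by rewrite inE => /fg ->.
Qed.

(** Moves every domain of integration into an indicator factor, so that linearity, domination and
    Fubini are needed on the whole line only. *)
Lemma cintegral_mkcond D f : cintegral D f = \cint (fun x => (\1_D x)%:C%C * f x).
Proof.
rewrite /cintegral Rintegral_mkcond [X in (_ +i* X)%C]Rintegral_mkcond.
congr (_ +i* _)%C; apply: eq_Rintegral => x _; rewrite patchE indicE;
by case: (_ \in _); rewrite ?mul1r ?mul0r.
Qed.

Lemma cintegrable_meas f : cintegrable f -> cmeas f.
Proof.
by move=> [/integrableP[/measurable_EFinP ? _] /integrableP[/measurable_EFinP ? _]].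
Qed.

Lemma cintegrable_dom f (G : R -> R) : cmeas f -> (forall x, cmod (f x) <= G x) ->
  intg G -> cintegrable f.
Proof.
move=> [f1 f2] fG iG; split.
  by apply: integrable_dom iG => // x; apply: le_trans (fG x); exact: Re_le_cmod.
by apply: integrable_dom iG => // x; apply: le_trans (fG x); exact: Im_le_cmod.
Qed.

Lemma integrable_cmod f : cintegrable f -> intg (fun x => cmod (f x)).
Proof.
move=> fi; have [f1 f2] := fi.
have i : intg (fun x => `|Re (f x)| + `|Im (f x)|).
  exact: (integrableD measurableT (integrable_norm f1) (integrable_norm f2)).
apply: integrable_dom i; first exact/measurable_cmod/cintegrable_meas.
by move=> x; rewrite ger0_norm ?cmod_ge0// cmod_le_ReIm.
Qed.

Lemma cintegrableD f g : cintegrable f -> cintegrable g ->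
  cintegrable (fun x => f x + g x).
Proof.
move=> [f1 f2] [g1 g2]; split.
  by under eq_fun do rewrite ReD; exact: (integrableD measurableT f1 g1).
by under eq_fun do rewrite ImD; exact: (integrableD measurableT f2 g2).
Qed.

Lemma cintegralD f g : cintegrable f -> cintegrable g ->
  \cint (fun x => f x + g x) = \cint f + \cint g.
Proof.
move=> [f1 f2] [g1 g2]; rewrite /cintegral.
under eq_Rintegral do rewrite ReD.
rewrite RintegralD//; under [X in (_ +i* X)%C = _]eq_Rintegral do rewrite ImD.
by rewrite RintegralD.
Qed.

Lemma cintegrableZl c f : cintegrable f -> cintegrable (fun x => c * f x).
Proof.
move=> fi; have fc := integrable_cmod fi.
have := integrableZl measurableT (cmod c) fc.
apply: cintegrable_dom.
  by apply: cmeasM; [exact: cmeas_cst|exact: cintegrable_meas].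
by move=> x; rewrite cmodM.
Qed.

Lemma integrableZlr a (f : R -> R) : intg f -> intg (fun x => a * f x).
Proof. by move=> /(integrableZl measurableT a). Qed.

Lemma cintegralZl c f : cintegrable f -> \cint (fun x => c * f x) = c * \cint f.
Proof.
move=> [f1 f2]; rewrite /cintegral.
under eq_Rintegral do rewrite ReM.
rewrite RintegralB//; [|exact: integrableZlr|exact: integrableZlr].
under [X in (_ +i* X)%C = _]eq_Rintegral do rewrite ImM.
rewrite RintegralD//; [|exact: integrableZlr|exact: integrableZlr].
rewrite !RintegralZl//.
by case: c => c1 c2.
Qed.

Lemma cintegrable0 : cintegrable (fun=> 0 : R[i]).
Proof. by split; exact: integrable0. Qed.

Lemma cintegral0 : \cint (fun=> 0) = 0 :> R[i].
Proof. by rewrite /cintegral /=; congr (_ +i* _)%C; rewrite /Rintegral integral0. Qed.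

Lemma cintegrable_sum I (s : seq I) (P : pred I) (F : I -> R -> R[i]) :
  (forall i, P i -> cintegrable (F i)) ->
  cintegrable (fun x => \sum_(i <- s | P i) F i x).
Proof.
move=> iF; elim: s => [|i s IH].
  rewrite (_ : (fun x => _) = (fun=> 0)); first exact: cintegrable0.
  by apply/funext => x; rewrite big_nil.
rewrite (_ : (fun x => _) = (fun x => if P i then F i x + \sum_(j <- s | P j) F j x
  else \sum_(j <- s | P j) F j x)); last by apply/funext => x; rewrite big_cons.
case: (boolP (P i)) => [Pi|_]; last exact: IH.
by apply: cintegrableD => //; exact: iF.
Qed.

Lemma cintegral_sum I (s : seq I) (P : pred I) (F : I -> R -> R[i]) :
  (forall i, P i -> cintegrable (F i)) ->
  \cint (fun x => \sum_(i <- s | P i) F i x) = \sum_(i <- s | P i) \cint (F i).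
Proof.
move=> iF; elim: s => [|i s IH].
  rewrite big_nil -[RHS]cintegral0; apply: eq_cintegral => x _; exact: big_nil.
transitivity (\cint (fun x => if P i then F i x + \sum_(j <- s | P j) F j x
  else \sum_(j <- s | P j) F j x)); first by apply: eq_cintegral => x _; rewrite big_cons.
rewrite big_cons; case: (boolP (P i)) => [Pi|_]; last exact: IH.
rewrite cintegralD ?IH//; [exact: iF|exact: cintegrable_sum].
Qed.

(** The rotation argument: with [z] the integral, [|z|^2] is the integral of [Re (conj z * f)],
    whose integrand is at most [|z| |f|]; then divide by [|z|]. Bounding the two parts separately
    would lose a constant factor. *)
Lemma cmod_cintegral f : cintegrable f -> cmod (\cint f) <= \int[mu]_x cmod (f x).
Proof.
move=> fi; have [f1 f2] := fi; set z := \cint f.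
have [->|z0] := eqVneq z 0.
  by rewrite cmod0; apply: Rintegral_ge0 => x _; exact: cmod_ge0.
suff : cmod z ^+ 2 <= cmod z * \int[mu]_x cmod (f x).
  by rewrite expr2 ler_pM2l// cmod_gt0.
have -> : cmod z ^+ 2 = \int[mu]_x (Re z * Re (f x) + Im z * Im (f x)).
  by rewrite RintegralD//; [rewrite !RintegralZl// cmod_sqr !expr2|exact: integrableZlr..].
have ci := integrable_cmod fi.
rewrite -RintegralZl//; apply: le_Rintegral => //.
- exact: (integrableD measurableT (integrableZlr _ f1) (integrableZlr _ f2)).
- exact: integrableZlr.
move=> x _; rewrite -[cmod z]cmodN -cmodN.
have -> : cmod (- (- z)) = cmod (conjc z) by rewrite opprK !cmodE; case: (z) => a b /=; rewrite sqrrN.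
rewrite -cmodM; apply: le_trans (Re_le_cmod _).
by apply: le_trans (ler_norm _); rewrite ReM; case: (z) => a b /=; rewrite mulNr opprK.
Qed.

Lemma cmod_cintegral_le f (G : R -> R) : cmeas f -> (forall x, cmod (f x) <= G x) ->
  intg G -> cmod (\cint f) <= \int[mu]_x G x.
Proof.
move=> mf fG iG; have fi := cintegrable_dom mf fG iG.
by apply: le_trans (cmod_cintegral fi) _; apply: le_Rintegral => //; exact: integrable_cmod.
Qed.

Lemma cintegrable_affine a b f : 0 < a -> cintegrable f ->
  cintegrable (fun x => f (a * x + b)).
Proof.
move=> a0 [f1 f2]; split; [exact: (integrable_affine b a0 f1)|exact: (integrable_affine b a0 f2)].
Qed.

Lemma cintegral_affine a b f : 0 < a -> cintegrable f ->
  \cint (fun x => f (a * x + b)) = (a^-1)%:C%C * \cint f.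
Proof.
move=> a0 [f1 f2]; rewrite /cintegral.
rewrite (Rintegral_affine b a0 f1) (Rintegral_affine b a0 f2).
by apply/eqP; rewrite eq_complex ReM ImM /= !mul0r subr0 addr0 !eqxx.
Qed.

Lemma cintegrable_decay f (C : R) : cmeas f ->
  (forall x, cmod (f x) <= C / oneDsqr x) -> cintegrable f.
Proof. by move=> mf fC; apply: cintegrable_dom mf fC _; exact: integrable_oneDsqr_decay. Qed.

End ComplexIntegral.

(** * Dominated convergence and Fubini's theorem *)

Section Limits.
Variable R : realType.
Local Notation Re := (@complex.Re R).
Local Notation Im := (@complex.Im R).
Local Notation mu := (@lebesgue_measure R).
Local Notation intg f := (mu.-integrable setT (EFin \o f)).
Local Notation "\cint f" := (cintegral setT f) (at level 10).

Lemma Rintegral_dominated_cvg (f_ : nat -> R -> R) (f G : R -> R) :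
  (forall n, measurable_fun setT (f_ n)) ->
  (forall x, f_ n x @[n --> \oo] --> f x) ->
  (forall n x, `|f_ n x| <= G x) -> intg G ->
  (\int[mu]_x f_ n x) @[n --> \oo] --> \int[mu]_x f x.
Proof.
move=> mf_ cf fG iG.
have mf : measurable_fun setT f by apply: (measurable_fun_cvg mf_) => x _; exact: cf.
have m1 n : measurable_fun setT (fun x => (f_ n x)%:E) by exact/measurable_EFinP.
have m2 : measurable_fun setT (EFin \o f) by exact/measurable_EFinP.
have c x : setT x -> (f_ n x)%:E @[n --> \oo] --> (EFin \o f) x.
  by move=> _; apply: cvg_EFin; [exact: nearW|exact: cf].
have d x : forall n, setT x -> (`|(f_ n x)%:E| <= (EFin \o G) x)%E.
  by move=> n _; rewrite lee_fin.
have [fi _ H] := @dominated_convergence _ _ _ mu setT measurableT _ _ _ m1 m2 (aeW mu c) iG (aeW mu d).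
by apply: fine_cvg; rewrite fineK//; exact: integrable_fin_num.
Qed.

Lemma cintegral_dominated_cvg (f_ : nat -> R -> R[i]) (f : R -> R[i]) (G : R -> R) :
  (forall n, cmeas (f_ n)) ->
  (forall x, Re (f_ n x) @[n --> \oo] --> Re (f x)) ->
  (forall x, Im (f_ n x) @[n --> \oo] --> Im (f x)) ->
  (forall n x, cmod (f_ n x) <= G x) -> intg G ->
  Re (\cint (f_ n)) @[n --> \oo] --> Re (\cint f) /\
  Im (\cint (f_ n)) @[n --> \oo] --> Im (\cint f).
Proof.
move=> mf c1 c2 fG iG; split; apply: (Rintegral_dominated_cvg (G := G)) => //.
- by move=> n; have [] := mf n.
- by move=> n x; apply: le_trans (Re_le_cmod _) (fG n x).
- by move=> n; have [] := mf n.
- by move=> n x; apply: le_trans (Im_le_cmod _) (fG n x).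
Qed.

(** The product majorant does double duty: it makes each section integrable, and through Tonelli it
    makes [F] integrable on the plane. *)
Lemma Rintegral_Fubini (F : measurableTypeR R * measurableTypeR R -> R) (a b : R -> R) : measurable_fun setT F ->
  (forall x y, `|F (x, y)| <= a x * b y) -> intg a -> intg b ->
  \int[mu]_x \int[mu]_y F (x, y) = \int[mu]_y \int[mu]_x F (x, y).
Proof.
move=> mF Fab ia ib.
have i1 x : intg (fun y => F (x, y)).
  apply: (integrable_dom (G := fun y => a x * b y)) => //; last exact: integrableZlr.
  exact: measurableT_comp mF _.
have i2 y : intg (fun x => F (x, y)).
  apply: (integrable_dom (G := fun x => b y * a x)) => //; last exact: integrableZlr.
    exact: measurableT_comp mF _.
  by move=> x; rewrite mulrC.
have H x : ((\int[mu]_y F (x, y))%:E = \int[mu]_y (F (x, y))%:E)%E.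
  by rewrite fineK//; exact: (integrable_fin_num measurableT (i1 x)).
have H' y : ((\int[mu]_x F (x, y))%:E = \int[mu]_x (F (x, y))%:E)%E.
  by rewrite fineK//; exact: (integrable_fin_num measurableT (i2 y)).
rewrite /Rintegral; congr fine.
under eq_integral do rewrite H.
under [RHS]eq_integral do rewrite H'.
apply: (Fubini (f := EFin \o F)).
apply/integrable12ltyP; first exact/measurable_EFinP.
have ca := integrable_norm ia; have cb := integrable_norm ib.
apply: (@le_lt_trans _ _ (\int[mu]_x ((\int[mu]_y `|b y|) * `|a x|)%:E)%E); last first.
  exact: (integrable_lty measurableT (integrableZlr _ ca)).
apply: ge0_le_integral => //.
- by move=> x _; exact: integral_ge0.
- apply: (@measurable_fun_fubini_tonelli_F _ _ _ _ _ mu (fun z => `|(F z)%:E|%E)) => //.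
  by do 2 apply: measurableT_comp => //.
- by have /integrableP[] := integrableZlr (\int[mu]_y `|b y|) ca.
move=> x _; rewrite EFinM fineK; last exact: (integrable_fin_num measurableT cb).
rewrite muleC -ge0_integralZl//; last by have /integrableP[] := cb.
apply: ge0_le_integral => //.
- by have /integrableP[m _] := integrable_norm (i1 x).
- by have /integrableP[] := integrableZlr `|a x| cb.
by move=> y _; rewrite -EFinM /= lee_fin -normrM (le_trans (Fab x y))// ler_norm.
Qed.

Lemma cintegral_Fubini (F : measurableTypeR R * measurableTypeR R -> R[i]) (a b : R -> R) : cmeas F ->
  (forall x y, cmod (F (x, y)) <= a x * b y) -> intg a -> intg b ->
  \cint (fun x => \cint (fun y => F (x, y))) = \cint (fun y => \cint (fun x => F (x, y))).
Proof.
move=> [m1 m2] Fab ia ib; apply: (f_equal2 (@Complex R)).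
  apply: (Rintegral_Fubini m1 _ ia ib) => x y; exact: le_trans (Re_le_cmod _) (Fab x y).
apply: (Rintegral_Fubini m2 _ ia ib) => x y; exact: le_trans (Im_le_cmod _) (Fab x y).
Qed.

End Limits.

(** * Derivatives in a real variable and integrals with a parameter *)

Section ComplexDerivative.
Variable R : realType.
Implicit Types (f g : R -> R[i]) (t : R).
Local Notation Re := (@complex.Re R).
Local Notation Im := (@complex.Im R).
Local Notation mu := (@lebesgue_measure R).
Local Notation intg f := (mu.-integrable setT (EFin \o f)).
Local Notation "\cint f" := (cintegral setT f) (at level 10).

(** Carries existence together with the value, which the total operator [cderive] does not, so that
    the rules below can be chained. *)
Definition has_cderive f t (df : R[i]) :=
  is_derive t 1 (fun s => Re (f s)) (Re df) /\ is_derive t 1 (fun s => Im (f s)) (Im df).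

Lemma cderivable_has f t : cderivable f t -> has_cderive f t (cderive f t).
Proof. by move=> [d1 d2]; split; rewrite /= derive1E; exact: DeriveDef. Qed.

Lemma has_cderiveE f t df : has_cderive f t df -> cderive f t = df.
Proof.
move=> [d1 d2]; rewrite /cderive !derive1E.
by rewrite (@derive_val _ _ _ _ _ _ _ d1) (@derive_val _ _ _ _ _ _ _ d2); case: df {d1 d2}.
Qed.

Lemma has_cderiveM f g t df dg : has_cderive f t df -> has_cderive g t dg ->
  has_cderive (fun s => f s * g s) t (df * g t + f t * dg).
Proof.
move=> [f1 f2] [g1 g2]; split.
  rewrite (_ : (fun s => _) = (fun s => Re (f s)) * (fun s => Re (g s)) -
    (fun s => Im (f s)) * (fun s => Im (g s))); last by apply/funext => s; rewrite ReM.
  apply: (is_derive_eq (is_deriveB (is_deriveM f1 g1) (is_deriveM f2 g2))).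
  by rewrite ReD !ReM /GRing.scale /=; ring.
rewrite (_ : (fun s => _) = (fun s => Re (f s)) * (fun s => Im (g s)) +
    (fun s => Im (f s)) * (fun s => Re (g s))); last by apply/funext => s; rewrite ImM.
apply: (is_derive_eq (is_deriveD (is_deriveM f1 g2) (is_deriveM f2 g1))).
by rewrite ImD !ImM /GRing.scale /=; ring.
Qed.

Lemma has_cderive_cst (c : R[i]) t : has_cderive (fun=> c) t 0.
Proof. by split; exact: is_derive_cst. Qed.

Lemma has_cderive_real (h : R -> R) t dh : is_derive t 1 h dh ->
  has_cderive (fun s => (h s)%:C%C) t dh%:C%C.
Proof. by split => //=; exact: is_derive_cst. Qed.

Lemma has_cderive_comp f (h : R -> R) t df dh : is_derive t 1 h dh ->
  has_cderive f (h t) df -> has_cderive (fun s => f (h s)) t (dh%:C%C * df).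
Proof.
move=> dhh [f1 f2]; split.
  by have := is_derive1_comp f1 dhh; rewrite ReM /= mul0r subr0 mulrC.
by have := is_derive1_comp f2 dhh; rewrite ImM /= mul0r addr0 mulrC.
Qed.

Lemma has_cderive_cis (h : R -> R) t dh : is_derive t 1 h dh ->
  has_cderive (fun s => cis (h s)) t ((0 +i* dh)%C * cis (h t)).
Proof.
move=> dhh; split.
  have := is_derive1_comp (is_derive_cos (h t)) dhh.
  by move/is_derive_eq; apply; rewrite ReM /=; ring.
have := is_derive1_comp (is_derive_sin (h t)) dhh.
by move/is_derive_eq; apply; rewrite ImM /=; ring.
Qed.

Lemma has_cderive_continuous f : (forall t, exists df, has_cderive f t df) -> ccont f.
Proof.
move=> H; split => t; apply: differentiable_continuous; apply/derivable1_diffP;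
by have [df [d1 d2]] := H t; exact: ex_derive.
Qed.

Lemma cderivable_continuous f : (forall t, cderivable f t) -> ccont f.
Proof.
by move=> H; apply: has_cderive_continuous => t; exists (cderive f t); exact: cderivable_has.
Qed.

(** Hypotheses are confined to a neighbourhood []u, v[] of [a]: for the short-time transform a
    common majorant is available only while [sigma] stays between two positive bounds. *)
Lemma has_cderive_under_integral (f df : R -> R -> R[i]) (G : R -> R) (a u v : R) :
  u < a -> a < v ->
  (forall x, u < x < v -> cintegrable (f x)) ->
  (forall x y, u < x < v -> has_cderive (f ^~ y) x (df x y)) ->
  intg G -> (forall y, 0 <= G y) ->
  (forall x y, u < x < v -> cmod (df x y) <= G y) ->
  has_cderive (fun x => \cint (f x)) a (\cint (df a)).
Proof.
move=> ua av fi fd iG G0 dG.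
have Ia : `]u, v[%classic a by rewrite /= in_itv /= ua av.
have auv : u < a < v by rewrite ua.
split.
  have H1 x : `]u, v[%classic x -> intg (fun y => Re (f x y)).
    by rewrite /= in_itv /= => /fi[].
  have H2 x y : `]u, v[%classic x -> setT y -> derivable (fun x => Re (f x y)) x 1.
    by rewrite /= in_itv /= => /(fd x y)[] ? _ _.
  have H3 x y : `]u, v[%classic x -> setT y ->
      `|partial1of2 (fun x y => Re (f x y)) x y| <= G y.
    rewrite /= in_itv /= => xuv _; rewrite partial1of2E.
    have [d1 _] := fd x y xuv; rewrite derive_val.
    by rewrite (le_trans (Re_le_cmod _))// dG.
  have D := derivable_under_integral measurableT Ia H1 H2 G0 iG H3.
  apply: (DeriveDef D); rewrite -derive1E.
  rewrite (differentiation_under_integral measurableT Ia H1 H2 G0 iG H3).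
  apply: eq_Rintegral => y _; rewrite partial1of2E.
  by have [d1 _] := fd a y auv; rewrite derive_val.
have H1 x : `]u, v[%classic x -> intg (fun y => Im (f x y)).
  by rewrite /= in_itv /= => /fi[].
have H2 x y : `]u, v[%classic x -> setT y -> derivable (fun x => Im (f x y)) x 1.
  by rewrite /= in_itv /= => /(fd x y)[_] ? _.
have H3 x y : `]u, v[%classic x -> setT y ->
    `|partial1of2 (fun x y => Im (f x y)) x y| <= G y.
  rewrite /= in_itv /= => xuv _; rewrite partial1of2E.
  have [_ d1] := fd x y xuv; rewrite derive_val.
  by rewrite (le_trans (Im_le_cmod _))// dG.
have D := derivable_under_integral measurableT Ia H1 H2 G0 iG H3.
apply: (DeriveDef D); rewrite -derive1E.
rewrite (differentiation_under_integral measurableT Ia H1 H2 G0 iG H3).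
apply: eq_Rintegral => y _; rewrite partial1of2E.
by have [_ d1] := fd a y auv; rewrite derive_val.
Qed.

Lemma ccont_under_integral (f : R -> R -> R[i]) (G : R -> R) :
  (forall x, cmeas (f x)) -> (forall y, ccont (f ^~ y)) -> intg G ->
  (forall x y, cmod (f x y) <= G y) -> ccont (fun x => \cint (f x)).
Proof.
move=> mf cf iG fG.
have fi x : cintegrable (f x) by exact: cintegrable_dom (mf x) (fG x) iG.
have Iuv (x : R) : x \in (`]x - 1, x + 1[%classic : set R).
  by rewrite inE /= in_itv /=; apply/andP; split; lra.
split => x; (apply: (continuity_under_integral measurableT (u := x - 1) (v := x + 1) _ _ iG _ (Iuv x))).
- by move=> y _; have [] := fi y.
- by apply: aeW => y _ z _; have [c _] := cf y; exact: c.
- by move=> y _; apply: aeW => z _; exact: le_trans (Re_le_cmod _) (fG _ _).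
- by move=> y _; have [] := fi y.
- by apply: aeW => y _ z _; have [_ c] := cf y; exact: c.
- by move=> y _; apply: aeW => z _; exact: le_trans (Im_le_cmod _) (fG _ _).
Qed.

End ComplexDerivative.

(** * Quantitative decay of Schwartz windows *)

Section RapidDecay.
Variable R : realType.
Implicit Types (f g : R -> R[i]) (xi t : R).
Local Notation mu := (@lebesgue_measure R).
Local Notation intg f := (mu.-integrable setT (EFin \o f)).
Local Notation "\cint f" := (cintegral setT f) (at level 10).

(* Exponent 2: such functions stay integrable after multiplication by a factor
   of size 1 + u^2, be it a moment weight or the growth of the signal. *)
Definition rapid f := ccont f /\ exists C : R, forall u, cmod (f u) <= C / oneDsqr u ^+ 2.

Lemma rapidP f : rapid f ->
  ccont f /\ exists2 C : R, 0 <= C & forall u, cmod (f u) <= C / oneDsqr u ^+ 2.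
Proof.
move=> [cf [C fC]]; split => //; exists C => //.
have := fC 0; rewrite /oneDsqr expr0n /= addr0 expr1n divr1.
exact: le_trans (cmod_ge0 _).
Qed.

Lemma ler_oneDsqr_expV (C : R) u n : 0 <= C -> C / oneDsqr u ^+ n.+1 <= C / oneDsqr u.
Proof.
move=> C0; rewrite ler_wpM2l// lef_pV2 ?posrE ?exprn_gt0 ?oneDsqr_gt0//.
by rewrite exprS ler_peMr ?exprn_ege1 ?oneDsqr_ge1// ltW ?oneDsqr_gt0.
Qed.

Lemma rapid_decay f : rapid f -> exists2 C : R, 0 <= C & forall u, cmod (f u) <= C / oneDsqr u.
Proof.
by move=> /rapidP[_ [C C0 fC]]; exists C => // u; apply: le_trans (fC u) _; exact: ler_oneDsqr_expV.
Qed.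

Lemma rapid_integrable f : rapid f -> cintegrable f.
Proof.
move=> rf; have [C _ fC] := rapid_decay rf; apply: cintegrable_decay fC.
by apply: ccont_meas; case: rf.
Qed.

(** For [n <= 2] the weight [|u|^n] is at most [1 + u^2], so it costs one of the two powers of
    decay. *)
Lemma rapid_moment f n : (n <= 2)%N -> rapid f ->
  intg (fun u => cmod ((u ^+ n)%:C%C * f u)).
Proof.
move=> n2 /rapidP[cf [C C0 fC]].
apply: integrable_dom (integrable_oneDsqr_decay C).
  apply: continuous_measurable_fun; apply: continuous_cmod; apply: ccontM => //.
  by apply: ccont_real; exact: exprn_continuous.
move=> u; rewrite ger0_norm ?cmod_ge0// cmodM cmodr.
have h : `|u ^+ n| <= oneDsqr u.
  rewrite normrX /oneDsqr -(real_normK (num_real u)).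
  by case: n n2 => [|[|[|//]]] _; rewrite ?expr0 ?expr1; have := normr_ge0 u;
    set a := `|u|; nra.
have := ler_pM (normr_ge0 _) (cmod_ge0 _) h (fC u).
have -> // : oneDsqr u * (C / oneDsqr u ^+ 2) = C / oneDsqr u.
by field; rewrite gt_eqF// oneDsqr_gt0.
Qed.

Lemma schwartz_derivable g n t : schwartz g ->
  has_cderive (iter n (@cderive R) g) t (iter n.+1 (@cderive R) g t).
Proof. by move=> [s _]; apply: cderivable_has; exact: s. Qed.

Lemma schwartz_monomial_rapid g m n : schwartz g ->
  rapid (fun t => (t ^+ m)%:C%C * iter n (@cderive R) g t).
Proof.
move=> [s d]; split.
  apply: ccontM; first by apply: ccont_real; exact: exprn_continuous.
  by apply: cderivable_continuous => t; exact: s.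
(* Expanding [(1 + u^2)^2 = 1 + 2 u^2 + u^4] calls for the seminorms with weights of degree [m],
   [m + 2] and [m + 4], with coefficients 1, 2 and 1. *)
have [M0 h0] := d m n; have [M2 h2] := d m.+2 n; have [M4 h4] := d m.+4 n.
exists (M0 + 2 * M2 + M4) => u.
rewrite ler_pdivlMr ?exprn_gt0 ?oneDsqr_gt0//.
move: (h0 u) (h2 u) (h4 u); rewrite !cmodM !cmodr => e0 e2 e4.
have E2 : `|u ^+ m.+2| = `|u ^+ m| * u ^+ 2.
  by rewrite -addn2 exprD normrM [`|u ^+ 2|]ger0_norm ?sqr_ge0.
have E4 : `|u ^+ m.+4| = `|u ^+ m| * (u ^+ 2) ^+ 2.
  by rewrite -addn4 exprD normrM (exprM u 2 2) [`|(u ^+ 2) ^+ 2|]ger0_norm ?sqr_ge0.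
move: e0 e2 e4; rewrite E2 E4 /oneDsqr; set x := `|_|; set y := cmod _ => e0 e2 e4.
nra.
Qed.

Lemma schwartz_rapid g n : schwartz g -> rapid (iter n (@cderive R) g).
Proof.
move=> /(schwartz_monomial_rapid 0 n).
by rewrite (_ : (fun t => _) = iter n (@cderive R) g)//; apply/funext => t; rewrite expr0 mul1r.
Qed.

Lemma window3_rapid g : schwartz g -> rapid (window3 g).
Proof. by move=> /(schwartz_monomial_rapid 1 1). Qed.

End RapidDecay.

(** * Fourier transform: continuity, derivatives, decay *)

Section Fourier.
Variable R : realType.
Implicit Types (f g : R -> R[i]) (xi t : R).
Local Notation mu := (@lebesgue_measure R).
Local Notation intg f := (mu.-integrable setT (EFin \o f)).
Local Notation "\cint f" := (cintegral setT f) (at level 10).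

Lemma continuous_lin (c : R) : continuous (fun t : R => c * t).
Proof. by move=> t; apply: cvgM; [exact: cvg_cst|exact: cvg_id]. Qed.

Lemma continuous_phase xi : continuous (fun t : R => - (2 * pi * xi * t)).
Proof. by move=> t; apply: cvgN; exact: continuous_lin. Qed.

Lemma fourier_integrable f xi : cintegrable f ->
  cintegrable (fun t => f t * cis (- (2 * pi * xi * t))).
Proof.
move=> fi; apply: cintegrable_dom (integrable_cmod fi).
  apply: cmeasM; first exact: cintegrable_meas.
  by apply: ccont_meas; apply: ccont_cis; exact: continuous_phase.
by move=> t; rewrite cmodM cmod_cis mulr1.
Qed.

Lemma cmod_fourier_le f xi : cintegrable f ->
  cmod (fourier f xi) <= \int[mu]_t cmod (f t).
Proof.
move=> fi; apply: cmod_cintegral_le (integrable_cmod fi).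
  by apply: cintegrable_meas; exact: fourier_integrable.
by move=> t; rewrite cmodM cmod_cis mulr1.
Qed.

Lemma fourier_continuous f : cintegrable f -> ccont (fourier f).
Proof.
move=> fi; apply: (ccont_under_integral _ _ (integrable_cmod fi)).
- by move=> xi; apply: cintegrable_meas; exact: fourier_integrable.
- move=> t; apply: ccontM; first exact: ccont_cst.
  apply: ccont_cis => xi; apply: cvgN; apply: cvgM; last exact: cvg_cst.
  exact: continuous_lin.
- by move=> xi t; rewrite cmodM cmod_cis mulr1.
Qed.

Lemma is_derive_phase xi t : is_derive t 1 (fun t : R => - (2 * pi * xi * t)) (- (2 * pi * xi)).
Proof. by apply: is_derive_eq; rewrite /GRing.scale /= mulr1. Qed.

(* The integral of G(s + t) over t does not depend on s; differentiate at 0. *)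
Lemma cintegral_cderive_eq0 (G dG : R -> R[i]) (C : R) : cintegrable G ->
  (forall t, has_cderive G t (dG t)) -> (forall t, cmod (dG t) <= C / oneDsqr t) ->
  \cint dG = 0.
Proof.
move=> Gi GdG dGC.
have C0 : 0 <= C.
  have := dGC 0; rewrite /oneDsqr expr0n /= addr0 divr1.
  exact: le_trans (cmod_ge0 _).
have H : has_cderive (fun s => \cint (fun t => G (1 * t + s))) 0 (\cint (fun t => dG (1 * t + 0))).
  (* For [|s| < 1] one has [1 + t^2 <= 3 (1 + (t + s)^2)], whence the factor 3. Twice the difference
     of the two sides is [(2 t + 3 s)^2 + 4 - 3 s^2]. *)
  apply: (@has_cderive_under_integral _ (fun s t => G (1 * t + s)) (fun s t => dG (1 * t + s))
    (fun t => (3 * C) / oneDsqr t) 0 (-1) 1).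
  - by rewrite ltrN10.
  - by [].
  - by move=> s _; exact: cintegrable_affine.
  - move=> s t _; rewrite -[dG _]mul1r.
    apply: has_cderive_comp; last exact: GdG.
    by apply: is_derive_eq; rewrite add0r.
  - exact: integrable_oneDsqr_decay.
  - by move=> y; rewrite divr_ge0 ?mulr_ge0// ltW ?oneDsqr_gt0.
  - move=> s t /andP[s1 s2]; apply: le_trans (dGC _) _.
    rewrite ler_pdivrMr ?oneDsqr_gt0// mulrAC ler_pdivlMr ?oneDsqr_gt0//.
    rewrite [3 * C]mulrC -mulrA ler_wpM2l// mul1r /oneDsqr.
    have := sqr_ge0 (2 * t + 3 * s); have : s ^+ 2 <= 1 by nra.
    nra.
have E : (fun s => \cint (fun t => G (1 * t + s))) = (fun=> \cint G).
  by apply/funext => s; rewrite cintegral_affine// invr1 mul1r.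
move: H; rewrite E => /has_cderiveE; rewrite (has_cderiveE (has_cderive_cst _ _)) => ->.
by apply: eq_cintegral => t _; rewrite mul1r addr0.
Qed.

(** Integration by parts without boundary terms: the derivative of [f] times the exponential decays
    like [1 / (1 + t^2)] and so integrates to 0. *)
Lemma fourier_cderive f df xi : rapid f -> rapid df -> (forall t, has_cderive f t (df t)) ->
  fourier df xi = i2pi R * xi%:C%C * fourier f xi.
Proof.
move=> rf rdf fdf.
have fi := rapid_integrable rf; have dfi := rapid_integrable rdf.
have [C C0 fC] := rapid_decay rf; have [D D0 dfD] := rapid_decay rdf.
pose e t : R[i] := cis (- (2 * pi * xi * t)).
pose c : R[i] := (0 +i* (- (2 * pi * xi)))%C.
have He t : has_cderive e t (c * e t) by apply: has_cderive_cis; exact: is_derive_phase.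
have H t := has_cderiveM (fdf t) (He t).
have E t : cmod (df t * e t + f t * (c * e t)) <= (D + cmod c * C) / oneDsqr t.
  apply: le_trans (cmodD _ _) _; rewrite !cmodM /e cmod_cis !mulr1 mulrDl lerD//.
  by rewrite mulrC -mulrA ler_wpM2l ?cmod_ge0.
have := cintegral_cderive_eq0 (fourier_integrable xi fi) H E.
have -> : (fun t => df t * e t + f t * (c * e t)) =
    (fun t => df t * e t + c * (f t * e t)).
  by apply/funext => t; rewrite mulrCA.
rewrite cintegralD; last 2 first.
- exact: fourier_integrable.
- by apply: cintegrableZl; exact: fourier_integrable.
rewrite cintegralZl; last exact: fourier_integrable.
move/eqP; rewrite addr_eq0 => /eqP; rewrite -/(fourier df xi) -/(fourier f xi) => ->.
rewrite -mulNr; congr (_ * _).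
by apply/eqP; rewrite eq_complex ReM ImM /c /=; apply/andP; split; apply/eqP; ring.
Qed.

(** Two derivatives in time multiply the transform by a factor of modulus [(2 pi xi)^2], which is at
    least [xi^2]. The [L^1] norms of [g] and of its second derivative control the two summands of
    [1 + xi^2]. *)
Lemma schwartz_fourier_decay g : schwartz g ->
  exists2 C : R, 0 <= C & forall xi, cmod (fourier g xi) <= C / oneDsqr xi.
Proof.
move=> sg.
have r0 := schwartz_rapid 0 sg; have r1 := schwartz_rapid 1 sg; have r2 := schwartz_rapid 2 sg.
pose B0 := \int[mu]_t cmod (g t).
pose B2 := \int[mu]_t cmod (iter 2 (@cderive R) g t).
have B00 : 0 <= B0 by apply: Rintegral_ge0 => t _; exact: cmod_ge0.
have B20 : 0 <= B2 by apply: Rintegral_ge0 => t _; exact: cmod_ge0.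
exists (B0 + B2); first exact: addr_ge0.
move=> xi; have h0 := cmod_fourier_le xi (rapid_integrable r0).
have h2 := cmod_fourier_le xi (rapid_integrable r2).
rewrite (fourier_cderive xi r1 r2) in h2; last by move=> t; exact: (schwartz_derivable 1).
rewrite (fourier_cderive xi r0 r1) in h2; last by move=> t; exact: (schwartz_derivable 0).
rewrite ler_pdivlMr ?oneDsqr_gt0// /oneDsqr mulrDr mulr1; apply: lerD; first exact: h0.
apply: le_trans h2; rewrite mulrA cmodM mulrC ler_wpM2r ?cmod_ge0//.
rewrite !cmodM cmodr cmod_i2pi -expr2 exprMn real_normK ?num_real//.
rewrite ler_peMl ?sqr_ge0//.
by have := pi_ge2 R; set p := pi => ?; nra.
Qed.

Lemma schwartz_fourier_integrable g : schwartz g -> cintegrable (fourier g).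
Proof.
move=> sg; have [C _ gC] := schwartz_fourier_decay sg.
apply: cintegrable_decay gC; apply: ccont_meas; apply: fourier_continuous.
by apply: rapid_integrable; exact: (schwartz_rapid 0 sg).
Qed.

End Fourier.

(** * Poisson kernel and Fourier inversion at the origin *)

Section Poisson.
Variable R : realType.
Implicit Types (f g : R -> R[i]) (xi t a : R).
Local Notation mu := (@lebesgue_measure R).
Local Notation intg f := (mu.-integrable setT (EFin \o f)).
Local Notation "\cint f" := (cintegral setT f) (at level 10).

Lemma cvg_expRN_mul (f : R -> R) (M : R) : (forall x, `|f x| <= M) ->
  expR (- x) * f x @[x --> +oo] --> (0 : R).
Proof.
move=> fM; have e0 : expR (- x) * M @[x --> +oo] --> (0 : R).
  rewrite -[X in _ --> X](mul0r M); apply: cvgM; last exact: cvg_cst.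
  exact: cvgr_expR.
have e0' : - (expR (- x) * M) @[x --> +oo] --> (0 : R) by rewrite -oppr0; exact: cvgN.
apply: squeeze_cvgr e0' e0; apply: nearW => x; rewrite -ler_norml normrM.
by rewrite ger0_norm ?expR_ge0// ler_wpM2l ?expR_ge0.
Qed.

(** An antiderivative of [e^{-x} (1 + cos (a x))]. The summand 1 keeps the integrand nonnegative, as
    the improper fundamental theorem applied below demands; linearity removes it afterwards. *)
Definition poisson_primitive a x : R :=
  expR (- x) * ((a * sin (a * x) - cos (a * x)) / (1 + a ^+ 2) - 1).

Lemma is_derive_poisson_primitive a (x : R) :
  is_derive x (1 : R) (poisson_primitive a) (expR (- x) * (1 + cos (a * x))).
Proof.
have de : is_derive x (1 : R) (fun x : R => expR (- x)) (- expR (- x)).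
  have := is_derive1_comp (is_derive_expR (- x)) (is_deriveNid x 1).
  by rewrite mulrN1.
have dl : is_derive x (1 : R) (fun x : R => a * x) a.
  by apply: is_derive_eq; rewrite /GRing.scale /= mulr1.
have ds : is_derive x (1 : R) (fun x : R => sin (a * x)) (cos (a * x) * a).
  exact: is_derive1_comp (is_derive_sin _) dl.
have dc : is_derive x (1 : R) (fun x : R => cos (a * x)) (- sin (a * x) * a).
  exact: is_derive1_comp (is_derive_cos _) dl.
have a1 : 1 + a ^+ 2 != 0 by rewrite gt_eqF// ltr_pwDl// sqr_ge0.
have dq : is_derive x (1 : R) (fun x : R => (a * sin (a * x) - cos (a * x)) / (1 + a ^+ 2) - 1)
   ((a * (cos (a * x) * a) + sin (a * x) * a) / (1 + a ^+ 2)).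
  by apply: is_derive_eq; rewrite /GRing.scale /=; field.
apply: (is_derive_eq (is_deriveM de dq)); rewrite /GRing.scale /=; field.
exact: a1.
Qed.

Lemma integral0y_expR_cos a :
  (\int[mu]_(x in `[0%R, +oo[) (expR (- x) * (1 + cos (a * x)))%:E = (1 + (1 + a ^+ 2)^-1)%:E)%E.
Proof.
have D x := is_derive_poisson_primitive a x.
have a0 : 0 < 1 + a ^+ 2 by rewrite ltr_pwDl// sqr_ge0.
rewrite (@ge0_continuous_FTC2y _ _ (poisson_primitive a) 0 0).
- rewrite sub0e /poisson_primitive mulr0 sin0 cos0 mulr0 oppr0 expR0 -EFinN; congr EFin.
  by field; exact: lt0r_neq0.
- by move=> x _; apply: mulr_ge0; [exact: expR_ge0|have := cos_geN1 (a * x); lra].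
- apply: continuous_subspaceT => x; apply: cvgM.
    apply: (continuous_comp (f := -%R)); [exact: opp_continuous|exact: continuous_expR].
  apply: cvgD; first exact: cvg_cst.
  by apply: (continuous_comp (f := ( *%R a))); [exact: continuous_lin|exact: continuous_cos].
- apply: (@cvg_expRN_mul _ ((`|a| + 1) / (1 + a ^+ 2) + 1)) => x.
  apply: le_trans (ler_normB _ _) _; rewrite normr1 lerD2r normrM.
  rewrite [`|_^-1|]gtr0_norm ?invr_gt0// ler_wpM2r ?invr_ge0 ?(ltW a0)//.
  apply: le_trans (ler_normB _ _) _; rewrite lerD ?cos_max// normrM.
  by rewrite ler_piMr// sin_max.
- by move=> x _; exact: ex_derive.
- apply: cvg_at_right_filter; apply: differentiable_continuous; apply/derivable1_diffP.
  exact: ex_derive.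
- by move=> x _; rewrite derive1E derive_val.
Qed.

Lemma continuous_expR_norm : continuous (fun x : R => expR (- `|x|)).
Proof.
move=> x; apply: (continuous_comp (f := fun x : R => - `|x|)); last exact: continuous_expR.
by apply: cvgN; exact: norm_continuous.
Qed.

Lemma integral_expR_norm_cos1 a :
  (\int[mu]_x (expR (- `|x|) * (1 + cos (a * x)))%:E = (2 * (1 + (1 + a ^+ 2)^-1))%:E)%E.
Proof.
rewrite ge0_symfun_integralT.
- rewrite EFinM -integral0y_expR_cos; congr (_ * _)%E.
  rewrite (_ : [set x | _] = `[0, +oo[%classic); last first.
    by apply/seteqP; split => x /=; rewrite in_itv/= andbT.
  by apply: eq_integral => x; rewrite inE /= in_itv /= andbT => x0; rewrite ger0_norm.
- by move=> x; apply: mulr_ge0; [exact: expR_ge0|have := cos_geN1 (a * x); lra].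
- move=> x; apply: cvgM; first exact: continuous_expR_norm.
  apply: cvgD; first exact: cvg_cst.
  by apply: (continuous_comp (f := ( *%R a))); [exact: continuous_lin|exact: continuous_cos].
- by move=> x /=; rewrite normrN mulrN cosN.
Qed.

Lemma measurable_expR_norm_cos1 a :
  measurable_fun setT (fun x : R => expR (- `|x|) * (1 + cos (a * x))).
Proof.
apply: continuous_measurable_fun => x; apply: cvgM; first exact: continuous_expR_norm.
apply: cvgD; first exact: cvg_cst.
by apply: (continuous_comp (f := ( *%R a))); [exact: continuous_lin|exact: continuous_cos].
Qed.

(** For [a = 0] the preceding integrand is twice this function. *)
Lemma integrable_expR_norm : intg (fun x : R => expR (- `|x|)).
Proof.
have H : intg (fun x : R => expR (- `|x|) * (1 + cos (0 * x))).
  apply/integrableP; split; first by apply/measurable_EFinP; exact: measurable_expR_norm_cos1.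
  under eq_integral => x _.
    rewrite /= ger0_norm; last by rewrite mulr_ge0 ?expR_ge0// mul0r cos0.
    over.
  by rewrite integral_expR_norm_cos1 ltry.
apply: integrable_dom H.
  by apply: continuous_measurable_fun; exact: continuous_expR_norm.
move=> x; rewrite mul0r cos0 ger0_norm ?expR_ge0//.
by rewrite ler_peMr ?expR_ge0//; lra.
Qed.

Lemma integrable_expR_norm_cos a : intg (fun x : R => expR (- `|x|) * cos (a * x)).
Proof.
apply: integrable_dom integrable_expR_norm.
  apply: continuous_measurable_fun => x; apply: cvgM; first exact: continuous_expR_norm.
  by apply: (continuous_comp (f := ( *%R a))); [exact: continuous_lin|exact: continuous_cos].
by move=> x; rewrite normrM ger0_norm ?expR_ge0// ler_piMr ?expR_ge0// cos_max.
Qed.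

Lemma Rintegral_expR_norm : \int[mu]_x expR (- `|x|) = 2 :> R.
Proof.
have := integral_expR_norm_cos1 0.
rewrite expr0n /= addr0 invr1; under eq_integral do rewrite mul0r cos0 mulrC.
move=> /(congr1 fine); rewrite -/(Rintegral _ _ _) RintegralZl//; last exact: integrable_expR_norm.
by rewrite /=; lra.
Qed.

Lemma Rintegral_expR_norm_cos a :
  \int[mu]_x (expR (- `|x|) * cos (a * x)) = 2 / (1 + a ^+ 2).
Proof.
have := integral_expR_norm_cos1 a => /(congr1 fine); rewrite -/(Rintegral _ _ _).
under eq_Rintegral do rewrite mulrDr mulr1.
rewrite RintegralD//; [|exact: integrable_expR_norm|exact: integrable_expR_norm_cos].
by rewrite Rintegral_expR_norm /= mulrDr mulr1 => /addrI.
Qed.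

Lemma integrable_expR_norm_sin a : intg (fun x : R => expR (- `|x|) * sin (a * x)).
Proof.
apply: integrable_dom integrable_expR_norm.
  apply: continuous_measurable_fun => x; apply: cvgM; first exact: continuous_expR_norm.
  by apply: (continuous_comp (f := ( *%R a))); [exact: continuous_lin|exact: continuous_sin].
by move=> x; rewrite normrM ger0_norm ?expR_ge0// ler_piMr ?expR_ge0// sin_max.
Qed.

Lemma Rintegral_expR_norm_sin a :
  \int[mu]_x (expR (- `|x|) * sin (a * x)) = 0.
Proof.
have i := integrable_expR_norm_sin a.
have := RintegralNx i.
under eq_Rintegral do rewrite normrN mulrN sinN mulrN -mulN1r.
by rewrite RintegralZl//; lra.
Qed.

Lemma fourier_expR_norm xi :
  fourier (fun x => (expR (- `|x|))%:C%C) xi = (2 / oneDsqr (2 * pi * xi))%:C%C.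
Proof.
rewrite /fourier /cintegral; congr (_ +i* _)%C.
  rewrite -Rintegral_expR_norm_cos; apply: eq_Rintegral => x _.
  by rewrite ReM /= cosN mul0r subr0.
rewrite -[RHS](mulr0 (-1)) -(Rintegral_expR_norm_sin (2 * pi * xi)).
rewrite -RintegralZl//; last exact: integrable_expR_norm_sin.
apply: eq_Rintegral => x _.
by rewrite ImM /= sinN mul0r addr0 mulN1r mulrN.
Qed.

(** Mass 1 makes the dilates of this kernel an approximate identity. *)
Lemma Rintegral_poisson : \int[mu]_t (2 / oneDsqr (2 * pi * t)) = 1 :> R.
Proof.
have i := integrable_oneDsqr_decay (2 : R).
have pi2 : 0 < 2 * pi :> R by rewrite mulr_gt0// pi_gt0.
have := Rintegral_affine 0 pi2 i.
under eq_Rintegral do rewrite addr0.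
move=> ->; rewrite RintegralZl//; last exact: integrable_oneDsqrV.
suff -> : \int[mu]_t (oneDsqr t)^-1 = pi :> R by rewrite mulVf ?lt0r_neq0.
rewrite /Rintegral ge0_symfun_integralT//=.
- rewrite (_ : [set x | _] = `[0, +oo[%classic); last first.
    by apply/seteqP; split => x /=; rewrite in_itv/= andbT.
  by rewrite integral0y_oneDsqr -EFinM /=; field.
- exact: continuous_oneDsqrV.
- by move=> x; rewrite /= /oneDsqr sqrrN.
Qed.

(** Fubini does not apply to the undamped double integral. With the damping factor [p (e n * xi)] it
    does, and the result is the mean of [s |-> g (e n * s)] against the Poisson kernel. As [e n]
    tends to 0 both sides converge by dominated convergence: one because [fourier g] is integrable,
    the other because [g] is bounded and continuous. *)
Lemma fourier_inversion0 g : ccont g -> (exists M, forall t, cmod (g t) <= M) ->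
  cintegrable g -> cintegrable (fourier g) -> \cint (fourier g) = g 0.
Proof.
move=> cg [M gM] gi ghi.
pose e (n : nat) : R := (n.+1%:R)^-1.
have e0 n : 0 < e n by rewrite invr_gt0.
have ecvg : e n @[n --> \oo] --> 0 by exact: cvg_harmonic.
pose K (x : R) : R := 2 / oneDsqr (2 * pi * x).
have K0 x : 0 <= K x by rewrite divr_ge0// ltW// oneDsqr_gt0.
have pi2 : 0 < 2 * pi :> R by rewrite mulr_gt0// pi_gt0.
have iK : intg K.
  have := integrable_affine 0 pi2 (integrable_oneDsqr_decay (2 : R)).
  by under eq_fun do rewrite addr0.
pose p (x : R) : R[i] := (expR (- `|x|))%:C%C.
have mp : cmeas p.
  by apply: ccont_meas; apply: ccont_real; exact: continuous_expR_norm.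
have pin : cintegrable p.
  apply: cintegrable_dom mp _ integrable_expR_norm => x.
  by rewrite cmodr ger0_norm ?expR_ge0.
have ip n : intg (fun x => expR (- `|e n * x|)).
  have := integrable_affine 0 (e0 n) integrable_expR_norm.
  by under eq_fun do rewrite addr0.
have key n : \cint (fun xi => p (e n * xi) * fourier g xi) = \cint (fun s => g (e n * s) * (K s)%:C%C).
  pose F (z : measurableTypeR R * measurableTypeR R) : R[i] :=
    p (e n * z.1) * (g z.2 * cis (- (2 * pi * z.1 * z.2))).
  have mF : cmeas F.
    apply: cmeasM.
      apply: (cmeas_comp mp); apply: (measurable_funM (measurable_cst _)); exact: measurable_fst.
    apply: cmeasM.
      apply: (cmeas_comp (ccont_meas cg)); exact: measurable_snd.
    apply: cmeas_cis; apply: measurable_funN; apply: measurable_funM; last exact: measurable_snd.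
    apply: (measurable_funM (measurable_cst _)); exact: measurable_fst.
  have bF x y : cmod (F (x, y)) <= expR (- `|e n * x|) * cmod (g y).
    by rewrite /F /= !cmodM cmod_cis mulr1 cmodr ger0_norm ?expR_ge0.
  have := cintegral_Fubini mF bF (ip n) (integrable_cmod gi).
  rewrite /F /=.
  under [X in X = _ -> _]eq_cintegral => x _.
    rewrite cintegralZl; last exact: fourier_integrable.
    rewrite -/(fourier g x).
    over.
  move=> ->.
  (* Since [x * y = (y / e n) * (e n * x)], dilation by [e n] turns the inner integral into the
     explicit transform of [p] at [y / e n]. *)
  have inner y : \cint (fun x => p (e n * x) * (g y * cis (- (2 * pi * x * y)))) =
    g y * ((e n)^-1 * K ((e n)^-1 * y))%:C%C.
    have -> : \cint (fun x => p (e n * x) * (g y * cis (- (2 * pi * x * y)))) =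
      \cint (fun x => g y * (p (e n * x + 0) * cis (- (2 * pi * ((e n)^-1 * y) * (e n * x + 0))))).
      apply: eq_cintegral => x _; rewrite mulrCA addr0; congr (_ * (_ * cis _)).
      by field; exact: lt0r_neq0.
    rewrite cintegralZl; last first.
      exact: (cintegrable_affine 0 (e0 n) (fourier_integrable _ pin)).
    rewrite (cintegral_affine 0 (e0 n) (fourier_integrable _ pin)).
    rewrite -/(fourier p ((e n)^-1 * y)) fourier_expR_norm -/(K _).
    by rewrite -rmorphM.
  transitivity (\cint (fun y => g y * ((e n)^-1 * K ((e n)^-1 * y))%:C%C)).
    by apply: eq_cintegral => y _; exact: inner.
  have iKg : cintegrable (fun s => g (e n * s) * (K s)%:C%C).
    apply: cintegrable_dom (integrableZlr M iK).
      apply: cmeasM; last by apply: cmeas_real; have /integrableP[/measurable_EFinP] := iK.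
      by apply: ccont_meas; apply: ccont_comp => //; exact: continuous_lin.
    by move=> x; rewrite cmodM cmodr ger0_norm ?K0// ler_wpM2r.
  have en0 : 0 < (e n)^-1 by rewrite invr_gt0.
  have := cintegral_affine 0 en0 iKg; rewrite invrK.
  move=> /(congr1 (fun z => ((e n)^-1)%:C%C * z)).
  rewrite mulrA -rmorphM mulVf ?lt0r_neq0// mul1r => <-.
  rewrite -cintegralZl; last exact: (cintegrable_affine 0 en0 iKg).
  apply: eq_cintegral => y _; rewrite addr0 (mulrA (e n)) mulfV ?lt0r_neq0// mul1r rmorphM.
  by rewrite mulrCA.
have L : \cint (fun s => g 0 * (K s)%:C%C) = g 0.
  rewrite cintegralZl; last first.
    apply: cintegrable_dom (iK); first by apply: cmeas_real; have /integrableP[/measurable_EFinP] := iK.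
    by move=> x; rewrite cmodr ger0_norm.
  rewrite /cintegral /= Rintegral_poisson.
  have -> : \int[mu]_x (0 : R) = 0 by rewrite /Rintegral integral0.
  by rewrite mulr1.
have ec x : e n * x @[n --> \oo] --> 0.
  by rewrite -[X in _ --> X](mul0r x); apply: cvgM => //; exact: cvg_cst.
have [l1 l2] : complex.Re (\cint (fun s => g (e n * s) * (K s)%:C%C)) @[n --> \oo] --> complex.Re (g 0) /\
   complex.Im (\cint (fun s => g (e n * s) * (K s)%:C%C)) @[n --> \oo] --> complex.Im (g 0).
  rewrite -[in X in _ --> X /\ _]L -[in X in _ /\ (_ --> X)]L; have [g1 g2] := cg.
  apply: (cintegral_dominated_cvg (G := fun s => M * K s)); last exact: integrableZlr.
  - move=> n; apply: cmeasM; last by apply: cmeas_real; have /integrableP[/measurable_EFinP] := iK.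
    by apply: ccont_meas; apply: ccont_comp => //; exact: continuous_lin.
  - move=> x; under eq_fun do rewrite ReM /= mulr0 subr0.
    rewrite ReM /= mulr0 subr0; apply: cvgM; [|exact: cvg_cst].
    exact: (cvg_comp _ _ (ec x) (g1 0)).
  - move=> x; under eq_fun do rewrite ImM /= mulr0 add0r.
    rewrite ImM /= mulr0 add0r; apply: cvgM; [|exact: cvg_cst].
    exact: (cvg_comp _ _ (ec x) (g2 0)).
  - by move=> n x; rewrite cmodM cmodr ger0_norm// ler_wpM2r.
have [m1 m2] : complex.Re (\cint (fun xi => p (e n * xi) * fourier g xi)) @[n --> \oo] --> complex.Re (\cint (fourier g)) /\
   complex.Im (\cint (fun xi => p (e n * xi) * fourier g xi)) @[n --> \oo] --> complex.Im (\cint (fourier g)).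
  have pc x : expR (- `|e n * x|) @[n --> \oo] --> (1 : R).
    rewrite -expR0 -oppr0 -(normr0 R).
    exact: (cvg_comp _ _ (ec x) (@continuous_expR_norm 0)).
  have pcM x c : expR (- `|e n * x|) * c @[n --> \oo] --> c.
    by rewrite -[X in _ --> X]mul1r; apply: cvgM; [exact: pc|exact: cvg_cst].
  apply: (cintegral_dominated_cvg (G := fun s => cmod (fourier g s))); last exact: integrable_cmod.
  - move=> n; apply: cmeasM; last exact: cintegrable_meas.
    by apply: ccont_meas; apply: (@ccont_comp _ p); [apply: ccont_real; exact: continuous_expR_norm|exact: continuous_lin].
  - move=> x; under eq_fun do rewrite ReM /= mul0r subr0.
    exact: pcM.
  - move=> x; under eq_fun do rewrite ImM /= mul0r addr0.
    exact: pcM.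
  - move=> n x; have e1 : expR (- `|e n * x|) <= 1 by rewrite -[leRHS]expR0 ler_expR oppr_le0.
    by rewrite cmodM cmodr ger0_norm ?expR_ge0// ler_piMl ?cmod_ge0.
apply/eqP; rewrite eq_complex; apply/andP; split; apply/eqP.
  have := cvg_lim (@Rhausdorff R) l1; rewrite -(cvg_lim (@Rhausdorff R) m1) => <-.
  by congr (lim (_ @ \oo)); apply/funext => n; rewrite key.
have := cvg_lim (@Rhausdorff R) l2; rewrite -(cvg_lim (@Rhausdorff R) m2) => <-.
  by congr (lim (_ @ \oo)); apply/funext => n; rewrite key.
Qed.

End Poisson.

(** * Second-order Taylor bound *)

Section Taylor.
Variable R : realType.

(** The derivative of the auxiliary [H] is [eps (u - t) - (f' u - f' t)]. As [f'] is
    [eps]-Lipschitz, it has the sign of [u - t], so [H] is smallest at [t]. The opposite inequality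
    comes from applying this to [- f]. *)
Lemma taylor2_half (f : R -> R) (eps : R) : (forall x, derivable f x 1) ->
  (forall x, derivable (derive1 f) x 1) -> (forall x, `|derive1 (derive1 f) x| <= eps) ->
  forall t s, f (t + s) - f t - derive1 f t * s <= eps * s ^+ 2 / 2.
Proof.
move=> df ddf feps t s.
have L := le_lipschitz ddf feps.
pose H (u : R) := eps / 2 * (u - t) ^+ 2 - (f u - derive1 f t * (u - t)).
have dH (u : R) : is_derive u (1 : R) H (eps * (u - t) - (derive1 f u - derive1 f t)).
  have dfu : is_derive u (1 : R) f (derive1 f u) by rewrite derive1E; exact: DeriveDef.
  by apply: is_derive_eq; rewrite /GRing.scale /=; field.
have cH : continuous H.
  move=> u; apply: differentiable_continuous; apply/derivable1_diffP.
  by have := dH u => ?; exact: ex_derive.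
suff : H t <= H (t + s).
  by rewrite /H subrr expr0n /= !mulr0 subr0 addrAC subrr add0r; lra.
have [s0|s0|<-] := ltgtP 0 s; last by rewrite addr0.
- have ts : t < t + s by rewrite ltrDl.
  have [c] := MVT ts (fun u _ => dH u) (continuous_subspaceT cH).
  rewrite in_itv /= => /andP[c1 c2] E; rewrite -subr_ge0 E mulr_ge0//; last by lra.
  have := L t c; rewrite [`|c - t|]gtr0_norm ?subr_gt0// ler_norml => /andP[_]; lra.
- have ts : t + s < t by rewrite gtrDl.
  have [c] := MVT ts (fun u _ => dH u) (continuous_subspaceT cH).
  rewrite in_itv /= => /andP[c1 c2] E; rewrite -subr_le0 E mulr_le0_ge0//; last by lra.
  have := L t c; rewrite [`|c - t|]ltr0_norm ?subr_lt0// ler_norml => /andP[]; lra.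
Qed.

Lemma taylor2 (f : R -> R) (eps : R) : (forall x, derivable f x 1) ->
  (forall x, derivable (derive1 f) x 1) -> (forall x, `|derive1 (derive1 f) x| <= eps) ->
  forall t s, `|f (t + s) - f t - derive1 f t * s| <= eps * s ^+ 2 / 2.
Proof.
move=> df ddf feps t s; rewrite ler_norml taylor2_half// andbT.
have dN : derive1 (\- f) = \- (derive1 f).
  by apply/funext => x; rewrite /= derive1N//.
have dNN : derive1 (\- (derive1 f)) = \- (derive1 (derive1 f)).
  by apply/funext => x; rewrite /= derive1N//.
have := @taylor2_half (\- f) eps _ _ _ t s; rewrite dN dNN.
have -> : (\- f) (t + s) - (\- f) t - (\- derive1 f) t * s = - (f (t + s) - f t - derive1 f t * s).
  by rewrite /=; ring.
move=> H; rewrite lerNl; apply: H => x /=.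
- exact: derivableN.
- exact: derivableN.
- by rewrite normrN.
Qed.

End Taylor.

(** * Local approximation of the signal by pure tones *)

Section SignalEstimates.
Variables (R : realType) (K : nat) (A phi : 'I_K -> R -> R) (eps1 eps2 : R).
Hypothesis x_class : signal_class A phi eps1 eps2.
Hypothesis eps1_gt0 : 0 < eps1.
Hypothesis eps2_gt0 : 0 < eps2.
Local Notation mu := (@lebesgue_measure R).
Local Notation intg f := (mu.-integrable setT (EFin \o f)).
Local Notation "\cint f" := (cintegral setT f) (at level 10).
Implicit Types (f : R -> R[i]) (k l : 'I_K) (t tau : R).

Lemma amp_derivable k t : derivable (A k) t 1.
Proof. by have [d _] := amp_C1 x_class k; exact: (d 0%N). Qed.

Lemma phase_derivable k t : derivable (phi k) t 1.
Proof. by have [d _] := phase_C2 x_class k; exact: (d 0%N). Qed.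

Lemma freq_derivable k t : derivable (derive1 (phi k)) t 1.
Proof. by have [d _] := phase_C2 x_class k; exact: (d 1%N). Qed.

Lemma amp_continuous k : continuous (A k).
Proof.
by move=> t; apply: differentiable_continuous; apply/derivable1_diffP; exact: (@amp_derivable k).
Qed.

Lemma phase_continuous k : continuous (phi k).
Proof.
by move=> t; apply: differentiable_continuous; apply/derivable1_diffP; exact: (@phase_derivable k).
Qed.

Lemma amp_ge0 k t : 0 <= A k t.
Proof. exact/ltW/(amp_gt0 x_class). Qed.

Lemma amp_increment k t tau : `|A k (t + tau) - A k t| <= eps1 * `|tau|.
Proof.
have := le_lipschitz (@amp_derivable k) (amp_slow x_class k) t (t + tau).
by rewrite [t + tau - t]addrAC subrr add0r.
Qed.

Lemma phase_increment k t tau :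
  `|phi k (t + tau) - phi k t - derive1 (phi k) t * tau| <= eps2 * tau ^+ 2 / 2.
Proof.
exact: (taylor2 (@phase_derivable k) (@freq_derivable k) (freq_slow x_class k)).
Qed.

Lemma cmod_component k t : cmod (component A phi k t) = A k t.
Proof. by rewrite cmodM cmod_cis mulr1 cmodr ger0_norm// amp_ge0. Qed.

Lemma component_continuous k : ccont (component A phi k).
Proof.
apply: ccontM; first by apply: ccont_real; exact: amp_continuous.
apply: ccont_cis => t; apply: cvgM; first exact: cvg_cst.
exact: phase_continuous.
Qed.

Lemma le_normr_oneDsqr (x : R) : `|x| <= oneDsqr x.
Proof.
by rewrite /oneDsqr -(real_normK (num_real x)); have := normr_ge0 x; set a := `|x|; nra.
Qed.

(** The growth is linear; it is relaxed to [1 + tau^2] to be matched against the decay in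
    [rapid]. *)
Lemma cmod_component_le k t tau :
  cmod (component A phi k (t + tau)) <= (A k t + eps1) * oneDsqr tau.
Proof.
rewrite cmod_component; have := amp_increment k t tau; rewrite ler_norml => /andP[_].
have h1 : eps1 * `|tau| <= eps1 * oneDsqr tau by rewrite ler_wpM2l ?(ltW eps1_gt0)// le_normr_oneDsqr.
have h2 : A k t <= A k t * oneDsqr tau by rewrite ler_peMr ?amp_ge0// oneDsqr_ge1.
by move: h1 h2; rewrite mulrDl; lra.
Qed.

Definition rem_term k t tau : R[i] :=
  (A k (t + tau) - A k t)%:C%C * cis (2 * pi * phi k (t + tau))
  + component A phi k t * cis (2 * pi * derive1 (phi k) t * tau)
    * (cis (2 * pi * (phi k (t + tau) - phi k t - derive1 (phi k) t * tau)) - 1).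

Lemma component_shift k t tau : component A phi k (t + tau) =
  component A phi k t * cis (2 * pi * derive1 (phi k) t * tau) + rem_term k t tau.
Proof.
have H : component A phi k t * cis (2 * pi * derive1 (phi k) t * tau) *
    cis (2 * pi * (phi k (t + tau) - phi k t - derive1 (phi k) t * tau)) =
    (A k t)%:C%C * cis (2 * pi * phi k (t + tau)).
  rewrite /component -!mulrA -!cisD; congr (_ * cis _); ring.
rewrite /rem_term mulrBr H mulr1 rmorphB /component; ring.
Qed.

(** The linear term is the Lipschitz bound on the amplitude. In the quadratic one, [pi eps2] is
    [2 pi] from the phase times [eps2 / 2] from Taylor. *)
Lemma cmod_rem_term k t tau :
  cmod (rem_term k t tau) <= eps1 * `|tau| + pi * eps2 * A k t * tau ^+ 2.
Proof.
apply: le_trans (cmodD _ _) _; apply: lerD.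
  by rewrite cmodM cmod_cis mulr1 cmodr amp_increment.
rewrite cmodM [cmod (component _ _ _ _ * _)]cmodM cmod_component cmod_cis mulr1.
have -> : pi * eps2 * A k t * tau ^+ 2 = A k t * (2 * pi * (eps2 * tau ^+ 2 / 2)) by field.
rewrite ler_wpM2l ?amp_ge0//; apply: le_trans (cis_sub1_le _) _.
have p0 : 0 <= 2 * pi :> R by rewrite mulr_ge0// pi_ge0.
by rewrite normrM ger0_norm// ler_wpM2l// phase_increment.
Qed.

Lemma rem_term_continuous k t : ccont (rem_term k t).
Proof.
have cs : continuous (fun tau => t + tau).
  by move=> x; apply: cvgD; [exact: cvg_cst|exact: cvg_id].
have cA : continuous (fun tau => A k (t + tau)).
  by move=> x; exact: (continuous_comp (cs x) (@amp_continuous k _)).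
have cp : continuous (fun tau => phi k (t + tau)).
  by move=> x; exact: (continuous_comp (cs x) (@phase_continuous k _)).
apply: ccontD; apply: ccontM.
- by apply: ccont_real => x; apply: cvgB; [exact: cA|exact: cvg_cst].
- by apply: ccont_cis => x; apply: cvgM; [exact: cvg_cst|exact: cp].
- by apply: ccontM; [exact: ccont_cst|apply: ccont_cis; exact: continuous_lin].
apply: ccontD; last exact: ccont_cst.
apply: ccont_cis => x; apply: cvgM; first exact: cvg_cst.
apply: cvgB; last exact: continuous_lin.
by apply: cvgB; [exact: cp|exact: cvg_cst].
Qed.

Section Decomposition.
Variables (sigma : R -> R) (t : R).
Hypothesis s0 : 0 < sigma t.
Local Notation s := (sigma t).

Lemma rapid_scale f : rapid f -> ccont (fun tau => f (tau / s)).
Proof.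
move=> [cf _]; apply: (ccont_comp cf) => x.
by apply: cvgM; [exact: cvg_id|exact: cvg_cst].
Qed.

Lemma integrable_scale (G : R -> R) : intg G -> intg (fun tau => G (tau / s)).
Proof.
move=> iG; have := integrable_affine 0 (_ : 0 < s^-1) iG; rewrite invr_gt0 => /(_ s0).
by under eq_fun do rewrite addr0 mulrC.
Qed.

Lemma Rintegral_scale (G : R -> R) : intg G ->
  \int[mu]_tau G (tau / s) = s * \int[mu]_u G u.
Proof.
move=> iG; have := Rintegral_affine 0 (_ : 0 < s^-1) iG; rewrite invr_gt0 => /(_ s0).
by rewrite invrK => <-; apply: eq_Rintegral => x _; rewrite addr0 mulrC.
Qed.

(** The bound of [cmod_rem_term] times [|f (tau / s)| / s], in the variable [u = tau / s]: here
    [|tau| / s] is [|u|], and [tau^2 / s] is [s u^2], hence the extra [s] in the second term. *)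
Let major k f (u : R) := eps1 * cmod ((u ^+ 1)%:C%C * f u) +
  pi * eps2 * A k t * s * cmod ((u ^+ 2)%:C%C * f u).

Lemma major_integrable k f : rapid f -> intg (major k f).
Proof.
move=> rf; apply: (integrableD measurableT (f := EFin \o _) (g := EFin \o _)).
  exact: (integrableZlr _ (rapid_moment (isT : (1 <= 2)%N) rf)).
exact: (integrableZlr _ (rapid_moment (isT : (2 <= 2)%N) rf)).
Qed.

Definition rem_integrand f eta k tau : R[i] :=
  rem_term k t tau * (s^-1)%:C%C * f (tau / s) * cis (- (2 * pi * eta * tau)).

Lemma remainderE f eta :
  remainder A phi sigma f t eta = \sum_(k < K) \cint (rem_integrand f eta k).
Proof. by []. Qed.

Lemma cmod_rem_integrand f eta k tau : cmod (rem_integrand f eta k tau) <= major k f (tau / s).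
Proof.
rewrite /rem_integrand !cmodM cmod_cis mulr1 cmodr /major !cmodM !cmodr.
rewrite [`|s^-1|]gtr0_norm ?invr_gt0// expr1 normrM [`|s^-1|]gtr0_norm ?invr_gt0//.
rewrite [`|_ ^+ 2|]ger0_norm ?sqr_ge0//.
have := cmod_rem_term k t tau; have := cmod_ge0 (f (tau / s)).
set c := cmod (f _) => c0 h.
have -> : eps1 * (`|tau| / s * c) + pi * eps2 * A k t * s * ((tau / s) ^+ 2 * c) =
  (eps1 * `|tau| + pi * eps2 * A k t * tau ^+ 2) / s * c by field; exact: lt0r_neq0.
by rewrite ler_wpM2r// ler_wpM2r// invr_ge0 ltW.
Qed.

Lemma rem_integrand_measurable f eta k : rapid f -> cmeas (rem_integrand f eta k).
Proof.
move=> rf; apply: ccont_meas; apply: ccontM; last by apply: ccont_cis; exact: continuous_phase.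
apply: ccontM; last exact: rapid_scale.
by apply: ccontM; [exact: rem_term_continuous|exact: ccont_cst].
Qed.

Lemma rem_integrand_integrable f eta k : rapid f -> cintegrable (rem_integrand f eta k).
Proof.
move=> rf; apply: cintegrable_dom (@rem_integrand_measurable f eta k rf) _ _.
- exact: cmod_rem_integrand.
- by apply: integrable_scale; exact: major_integrable.
Qed.

(** Integrating the majorants gives the moments and so the terms of [Lambda]; the leading factor [s]
    is the Jacobian of [u = tau / s]. *)
Lemma cmod_remainder f eta : rapid f ->
  cmod (remainder A phi sigma f t eta) <= s * Lambda A eps1 eps2 sigma f t.
Proof.
move=> rf; rewrite remainderE; apply: le_trans (cmod_sum _ _ _) _.
have -> : s * Lambda A eps1 eps2 sigma f t = \sum_(k < K) s * \int[mu]_u major k f u.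
  rewrite -mulr_sumr; congr (_ * _); rewrite /Lambda.
  transitivity (\sum_(k < K) (eps1 * moment 1 f + pi * eps2 * A k t * s * moment 2 f)).
    rewrite big_split /= sumr_const card_ord -[_ *+ K]mulr_natl.
    rewrite mulr_sumr; congr (_ + _); first by ring.
    by apply: eq_bigr => k _; ring.
  apply: eq_bigr => k _; rewrite /major RintegralD//; last 2 first.
  - exact: (integrableZlr _ (rapid_moment (isT : (1 <= 2)%N) rf)).
  - exact: (integrableZlr _ (rapid_moment (isT : (2 <= 2)%N) rf)).
  rewrite !RintegralZl//.
  - exact: (rapid_moment (isT : (2 <= 2)%N) rf).
  - exact: (rapid_moment (isT : (1 <= 2)%N) rf).
apply: ler_sum => k _; rewrite -Rintegral_scale; last exact: major_integrable.
apply: cmod_cintegral_le.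
- exact: rem_integrand_measurable.
- exact: cmod_rem_integrand.
- by apply: integrable_scale; exact: major_integrable.
Qed.

Lemma stft_decomposition f eta : rapid f ->
  stft (signal A phi) sigma f t eta =
  \sum_(k < K) component A phi k t * fourier f (s * (eta - derive1 (phi k) t))
  + remainder A phi sigma f t eta.
Proof.
move=> rf; rewrite remainderE -big_split /=.
have fi := rapid_integrable rf.
have si : 0 < s^-1 by rewrite invr_gt0.
pose main k tau := component A phi k t * (s^-1)%:C%C *
   (f (s^-1 * tau + 0) * cis (- (2 * pi * (s * (eta - derive1 (phi k) t)) * (s^-1 * tau + 0)))).
have imain k : cintegrable (main k).
  by apply: cintegrableZl; exact: (cintegrable_affine 0 si (fourier_integrable _ fi)).
transitivity (\cint (fun tau => \sum_(k < K) (main k tau + rem_integrand f eta k tau))).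
  apply: eq_cintegral => tau _; rewrite /signal !mulr_suml; apply: eq_bigr => k _.
  rewrite component_shift /rem_integrand /main addr0.
  have -> : - (2 * pi * (s * (eta - derive1 (phi k) t)) * (s^-1 * tau)) =
     2 * pi * derive1 (phi k) t * tau + - (2 * pi * eta * tau) by field; exact: lt0r_neq0.
  by rewrite cisD (mulrC s^-1); ring.
rewrite cintegral_sum; last first.
  by move=> k _; apply: cintegrableD => //; exact: rem_integrand_integrable.
apply: eq_bigr => k _; rewrite cintegralD//; last exact: rem_integrand_integrable.
congr (_ + _); rewrite /main cintegralZl; last first.
  exact: (cintegrable_affine 0 si (fourier_integrable _ fi)).
rewrite (cintegral_affine 0 si (fourier_integrable _ fi)) invrK -/(fourier f _).
rewrite mulrA -(mulrA _ (s^-1)%:C%C) -rmorphM mulVf ?lt0r_neq0// mulr1//.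
Qed.

End Decomposition.
End SignalEstimates.

(** * Time derivative of the adaptive transform *)

Section TimeDerivative.
Variables (R : realType) (x : R -> R[i]) (B : R) (sigma : R -> R) (eta : R).
Hypothesis xc : ccont x.
Hypothesis xB : forall r, cmod (x r) <= B * oneDsqr r.
Hypothesis sigma_gt0 : forall s, 0 < sigma s.
Local Notation mu := (@lebesgue_measure R).
Local Notation intg f := (mu.-integrable setT (EFin \o f)).
Local Notation "\cint f" := (cintegral setT f) (at level 10).
Implicit Types (f g : R -> R[i]) (s r t : R).

Definition stft_kernel f s r : R[i] :=
  ((sigma s)^-1)%:C%C * f ((r - s) / sigma s) * cis (- (2 * pi * eta * (r - s))).

Lemma growth_ge0 : 0 <= B.
Proof.
have := xB 0; rewrite /oneDsqr expr0n /= addr0 mulr1.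
exact: le_trans (cmod_ge0 _).
Qed.

(** With [u = (r - s) / w], so that [r = s + w u], use [r^2 <= 2 s^2 + 2 w^2 u^2]. The constant
    depends only on the bounds for [s] and [w]. *)
Lemma oneDsqr_rescale S M s w r : `|s| <= S -> 0 < w -> w <= M ->
  oneDsqr r <= (1 + 2 * S ^+ 2 + 2 * M ^+ 2) * oneDsqr ((r - s) / w).
Proof.
move=> sS w0 wM; set u := (r - s) / w.
have -> : r = s + w * u by rewrite /u mulrCA mulfV ?lt0r_neq0// mulr1 addrC subrK.
have s2 : s ^+ 2 <= S ^+ 2.
  by rewrite -(real_normK (num_real s)) lerXn2r// nnegrE (le_trans _ sS).
have w2 : w ^+ 2 <= M ^+ 2 by rewrite lerXn2r// nnegrE ltW// (lt_le_trans w0).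
have u0 := sqr_ge0 u; have S0 := sqr_ge0 S.
have h1 : w ^+ 2 * u ^+ 2 <= M ^+ 2 * u ^+ 2 by rewrite ler_wpM2r.
have h2 : 0 <= S ^+ 2 * u ^+ 2 by rewrite mulr_ge0.
have h3 : (s + w * u) ^+ 2 <= 2 * s ^+ 2 + 2 * (w ^+ 2 * u ^+ 2).
  by have := sqr_ge0 (s - w * u); lra.
have M0 := sqr_ge0 M.
rewrite /oneDsqr; move: h1 h2 h3 u0 S0 M0 s2.
set a := s ^+ 2; set b := (s + w * u) ^+ 2; set c := w ^+ 2 * u ^+ 2.
set d := S ^+ 2; set e := M ^+ 2; set v := u ^+ 2 => *; lra.
Qed.

(** The preceding lemma trades decay in the rescaled variable for decay in [r], at the cost [L] per
    power. One of the two powers absorbs the growth of [x], the other remains. The constant is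
    uniform in [s], as differentiation under the integral requires. *)
Lemma stft_kernel_bound f S m M : rapid f -> 0 < m ->
  exists2 C : R, 0 <= C & forall s r, `|s| <= S -> m <= sigma s <= M ->
    cmod (x r * stft_kernel f s r) <= C / oneDsqr r.
Proof.
move=> /rapidP[_ [C C0 fC]] m0.
pose L := 1 + 2 * S ^+ 2 + 2 * M ^+ 2.
have L0 : 0 <= L by rewrite !addr_ge0// mulr_ge0// sqr_ge0.
exists (B * m^-1 * C * L ^+ 2).
  by rewrite !mulr_ge0 ?growth_ge0 ?sqr_ge0// invr_ge0 ltW.
move=> s r sS /andP[ms sM]; have w0 := sigma_gt0 s.
rewrite /stft_kernel !cmodM cmod_cis mulr1 cmodr gtr0_norm ?invr_gt0//.
set u := (r - s) / sigma s; set o := oneDsqr r; set o' := oneDsqr u.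
have o0 : 0 < o by exact: oneDsqr_gt0.
have o'0 : 0 < o' by exact: oneDsqr_gt0.
have h : o <= L * o' by exact: oneDsqr_rescale.
have hx : cmod (x r) <= B * o by exact: xB.
have hs : (sigma s)^-1 <= m^-1 by rewrite lef_pV2// posrE.
have hf : cmod (f u) <= C * (L / o) ^+ 2.
  have hi : o'^-1 <= L / o by rewrite ler_pdivlMr// mulrC ler_pdivrMr.
  apply: le_trans (fC u) _; rewrite ler_wpM2l// -exprVn.
  by apply: lerXn2r; rewrite ?nnegrE ?divr_ge0 ?invr_ge0// ltW.
have -> : B * m^-1 * C * L ^+ 2 / o = B * o * (m^-1 * (C * (L / o) ^+ 2)).
  by field; rewrite !lt0r_neq0.
apply: ler_pM; rewrite ?cmod_ge0//.
  by rewrite mulr_ge0 ?cmod_ge0// invr_ge0 ltW.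
by apply: ler_pM; rewrite ?cmod_ge0// invr_ge0 ltW.
Qed.

Lemma stft_kernel_continuous f s : rapid f -> ccont (stft_kernel f s).
Proof.
move=> [cf _].
have cs : continuous (fun r => r - s).
  by move=> r; apply: cvgB; [exact: cvg_id|exact: cvg_cst].
apply: ccontM.
  apply: ccontM; first exact: ccont_cst.
  apply: (ccont_comp cf) => r; apply: cvgM; [exact: cs|exact: cvg_cst].
apply: ccont_cis => r; apply: cvgN; apply: cvgM; [exact: cvg_cst|exact: cs].
Qed.

Lemma stft_kernel_integrable f s : rapid f -> cintegrable (fun r => x r * stft_kernel f s r).
Proof.
move=> rf; have [C _ hC] := stft_kernel_bound `|s| (sigma s) rf (sigma_gt0 s).
apply: (@cintegrable_decay _ _ C).
  by apply: ccont_meas; apply: ccontM => //; exact: stft_kernel_continuous.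
by move=> r; apply: hC => //; rewrite !lexx.
Qed.

Lemma stftE f s : rapid f -> stft x sigma f s eta = \cint (fun r => x r * stft_kernel f s r).
Proof.
move=> rf; have := cintegral_affine s ltr01 (stft_kernel_integrable s rf).
rewrite invr1 mul1r => <-; apply: eq_cintegral => tau _.
by rewrite /stft_kernel mul1r addrK (addrC tau) -!mulrA.
Qed.

(** The four terms come from the exponential, from the normalization [1 / sigma], and from the
    translation and the dilation in the argument of [g]. The dilation produces [u g'(u)], which is
    why [window3] appears. *)
Lemma stft_time_derivative g t : schwartz g ->
  (forall s, derivable sigma s 1) -> continuous (derive1 sigma) ->
  has_cderive (fun s => stft x sigma g s eta) t
    (i2pi R * eta%:C%C * stft x sigma g t eta
     - (derive1 sigma t / sigma t)%:C%C * stft x sigma g t eta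
     - ((sigma t)^-1)%:C%C * stft x sigma (cderive g) t eta
     - (derive1 sigma t / sigma t)%:C%C * stft x sigma (window3 g) t eta).
Proof.
move=> sg ds cds.
have r0 := schwartz_rapid 0 sg; have r1 := schwartz_rapid 1 sg; have r3 := window3_rapid sg.
pose q s := derive1 sigma s / sigma s.
pose dk s r : R[i] := i2pi R * eta%:C%C * stft_kernel g s r
     - (q s)%:C%C * stft_kernel g s r
     - ((sigma s)^-1)%:C%C * stft_kernel (cderive g) s r
     - (q s)%:C%C * stft_kernel (window3 g) s r.
have Dk s r : has_cderive (fun s => stft_kernel g s r) s (dk s r).
  have s0 := sigma_gt0 s; have sn0 := lt0r_neq0 s0.
  have dsg : is_derive s (1 : R) sigma (derive1 sigma s) by rewrite derive1E; exact: DeriveDef.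
  have d1 : is_derive s (1 : R) (fun s => (sigma s)^-1) (- (derive1 sigma s / (sigma s) ^+ 2)).
    by apply: (is_derive_eq (is_deriveV sn0 dsg)); rewrite /GRing.scale /=; field.
  have d2 : is_derive s (1 : R) (fun s => r - s) (-1).
    by apply: is_derive_eq; rewrite add0r mul1r.
  have d3 : is_derive s (1 : R) (fun s => (r - s) / sigma s)
      (- ((sigma s)^-1) - (r - s) / sigma s * q s).
    by apply: (is_derive_eq (is_deriveM d2 d1)); rewrite /GRing.scale /= /q; field.
  have d4 : is_derive s (1 : R) (fun s => - (2 * pi * eta * (r - s))) (2 * pi * eta).
    by apply: is_derive_eq; rewrite /GRing.scale /=; ring.
  have H := has_cderiveM (has_cderiveM (has_cderive_real d1)
    (has_cderive_comp d3 (schwartz_derivable 0 ((r - s) / sigma s) sg))) (has_cderive_cis d4).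
  move: H; rewrite /= => H.
  suff -> : dk s r = ((- (derive1 sigma s / sigma s ^+ 2))%:C%C * g ((r - s) / sigma s) +
       (sigma s)^-1%:C%C *
       ((- (sigma s)^-1 - (r - s) / sigma s * q s)%:C%C * cderive g ((r - s) / sigma s))) *
      cis (- (2 * pi * eta * (r - s))) +
      (sigma s)^-1%:C%C * g ((r - s) / sigma s) * ((0 +i* (2 * pi * eta))%C * cis (- (2 * pi * eta * (r - s)))) by [].
  rewrite /dk /stft_kernel /window3.
  have -> : (0 +i* (2 * pi * eta))%C = i2pi R * eta%:C%C.
    by apply/eqP; rewrite eq_complex ReM ImM /=; apply/andP; split; apply/eqP; ring.
  have -> : derive1 sigma s / sigma s ^+ 2 = q s * (sigma s)^-1 by rewrite /q; field.
  set u := (r - s) / sigma s.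
  rewrite rmorphN rmorphB rmorphN !rmorphM; ring.
(* By continuity of [sigma] and [sigma'], near [t] the width stays between [m] and [M] and its
   derivative below [D]; the majorant [G] is built from these bounds. *)
pose m := sigma t / 2; pose M := 2 * sigma t; pose D := `|derive1 sigma t| + 1.
have t0 := sigma_gt0 t.
have cs : continuous sigma.
  by move=> s; apply: differentiable_continuous; apply/derivable1_diffP; exact: ds.
have m0 : 0 < m by rewrite divr_gt0.
have [d /= d0 Hd] : \forall s \near t, [/\ `|s| <= `|t| + 1, m <= sigma s <= M & `|derive1 sigma s| <= D].
  near=> s; split.
  - have : `|t - s| <= 1 by near: s; apply: cvgr_dist_le => //; exact: cvg_id.
    by move=> h; have := ler_normB t (t - s); rewrite opprB addrC subrK; lra.
  - have : `|sigma t - sigma s| <= m by near: s; apply: cvgr_dist_le => //; exact: cs.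
    by rewrite ler_norml /m /M => /andP[]; lra.
  - have : `|derive1 sigma t - derive1 sigma s| <= 1 by near: s; apply: cvgr_dist_le => //; exact: cds.
    move=> h; have := ler_normB (derive1 sigma t) (derive1 sigma t - derive1 sigma s).
    by rewrite opprB addrC subrK /D; lra.
have Hd' s : t - d < s < t + d -> [/\ `|s| <= `|t| + 1, m <= sigma s <= M & `|derive1 sigma s| <= D].
  by move=> /andP[s1 s2]; apply: Hd; rewrite /ball /= ltr_norml; apply/andP; split; lra.
have [C0 C00 h0] := stft_kernel_bound (`|t| + 1) M r0 m0.
have [C1 C10 h1] := stft_kernel_bound (`|t| + 1) M r1 m0.
have [C3 C30 h3] := stft_kernel_bound (`|t| + 1) M r3 m0.
pose Q := D / m.
pose G r := (2 * pi * `|eta| * C0 + Q * C0 + m^-1 * C1 + Q * C3) / oneDsqr r.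
have D0 : 0 <= D by rewrite addr_ge0.
have Q0 : 0 <= Q by rewrite divr_ge0// ltW.
have := @has_cderive_under_integral R (fun s r => x r * stft_kernel g s r)
   (fun s r => x r * dk s r) G t (t - d) (t + d).
rewrite ltrBlDr !ltrDl => /(_ d0 d0) H.
have : has_cderive (fun s => \cint (fun r => x r * stft_kernel g s r)) t (\cint (fun r => x r * dk t r)).
  apply: H.
  - by move=> s _; exact: stft_kernel_integrable.
  - move=> s r _; have := has_cderiveM (has_cderive_cst (x r) s) (Dk s r).
    by rewrite mul0r add0r.
  - exact: integrable_oneDsqr_decay.
  - have mi : 0 <= m^-1 by rewrite invr_ge0 ltW.
    move=> r; rewrite divr_ge0 ?(ltW (oneDsqr_gt0 _))// !addr_ge0// !mulr_ge0//.
    exact: pi_ge0.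
  - move=> s r /Hd'[sS smM sD].
    have qQ : cmod (q s)%:C%C <= Q.
      rewrite cmodr /q normrM ler_pM// gtr0_norm ?invr_gt0// lef_pV2 ?posrE//.
      by case/andP: smM.
    have sm : cmod ((sigma s)^-1)%:C%C <= m^-1.
      by rewrite cmodr gtr0_norm ?invr_gt0// lef_pV2 ?posrE//; case/andP: smM.
    have -> : x r * dk s r = i2pi R * eta%:C%C * (x r * stft_kernel g s r)
     - (q s)%:C%C * (x r * stft_kernel g s r)
     - ((sigma s)^-1)%:C%C * (x r * stft_kernel (cderive g) s r)
     - (q s)%:C%C * (x r * stft_kernel (window3 g) s r) by rewrite /dk; ring.
    have k0 := h0 s r sS smM; have k1 := h1 s r sS smM; have k3 := h3 s r sS smM.
    have o0 := ltW (oneDsqr_gt0 r).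
    have -> : G r = 2 * pi * `|eta| * C0 / oneDsqr r + Q * C0 / oneDsqr r
        + m^-1 * C1 / oneDsqr r + Q * C3 / oneDsqr r by rewrite /G; ring.
    apply: le_trans (cmodD _ _) _; rewrite cmodN; apply: lerD.
      apply: le_trans (cmodD _ _) _; rewrite cmodN; apply: lerD.
        apply: le_trans (cmodD _ _) _; rewrite cmodN; apply: lerD.
          rewrite cmodM -[leRHS]mulrA; apply: ler_pM; rewrite ?cmod_ge0//.
          by rewrite cmodM cmod_i2pi cmodr.
        by rewrite cmodM -[leRHS]mulrA; apply: ler_pM; rewrite ?cmod_ge0.
      by rewrite cmodM -[leRHS]mulrA; apply: ler_pM; rewrite ?cmod_ge0.
    by rewrite cmodM -[leRHS]mulrA; apply: ler_pM; rewrite ?cmod_ge0.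
have -> : (fun s => stft x sigma g s eta) = (fun s => \cint (fun r => x r * stft_kernel g s r)).
  by apply/funext => s; rewrite stftE.
rewrite !stftE//.
have i0 := stft_kernel_integrable t r0; have i1 := stft_kernel_integrable t r1.
have i3 := stft_kernel_integrable t r3.
suff -> : \cint (fun r => x r * dk t r) = i2pi R * eta%:C%C * \cint (fun r => x r * stft_kernel g t r)
   - (q t)%:C%C * \cint (fun r => x r * stft_kernel g t r)
   - ((sigma t)^-1)%:C%C * \cint (fun r => x r * stft_kernel (cderive g) t r)
   - (q t)%:C%C * \cint (fun r => x r * stft_kernel (window3 g) t r) by [].
rewrite -!mulNr -!cintegralZl//.
rewrite -!cintegralD//; do ?[exact: cintegrableZl|apply: cintegrableD].
by apply: eq_cintegral => r _; rewrite /dk; ring.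
Unshelve. all: by end_near. Qed.

End TimeDerivative.

(** Write [d l - d k] as [(e - d k) - (e - d l)]; the term [l = k] then vanishes and may be added.
    In the application [e] is the frequency [eta], and the two sums are the main parts of [V] and of
    [V^{g'}]. *)
Lemma sum_recenter (F : comPzRingType) (I : finType) (p e : F) (c h d : I -> F) (k : I) :
  p * \sum_(l | l != k) c l * (d l - d k) * h l =
  p * (e - d k) * \sum_l c l * h l - \sum_l p * (e - d l) * (c l * h l).
Proof.
rewrite !mulr_sumr -sumrB [RHS](bigD1 k)//= subrr add0r.
by apply: eq_bigr => l _; ring.
Qed.

(** * Zones and the phase transformation: claims (a) and (b) *)

Section PhaseTransform.
Variables (R : realType) (K : nat) (A phi : 'I_K -> R -> R) (eps1 eps2 : R).
Hypothesis x_class : signal_class A phi eps1 eps2.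
Hypothesis eps1_gt0 : 0 < eps1.
Hypothesis eps2_gt0 : 0 < eps2.
Variables (g : R -> R[i]) (tau0 alpha : R).
Hypothesis g_window : window g tau0 alpha.
Variable sigma : R -> R.
Hypothesis sigma_width : window_width phi alpha sigma.
Local Notation mu := (@lebesgue_measure R).
Local Notation intg f := (mu.-integrable setT (EFin \o f)).
Local Notation "\cint f" := (cintegral setT f) (at level 10).
Local Notation x := (signal A phi).
Local Notation V := (stft x sigma g).
Implicit Types (k l : 'I_K) (t eta : R).

Let sg := window_schwartz g_window.
Let rg : rapid g := schwartz_rapid 0 sg.
Let rdg : rapid (cderive g) := schwartz_rapid 1 sg.
Let s0 := width_gt0 sigma_width.

(** The hypothesis on [sigma] concerns consecutive indices; gaps add up along the chain from [j] to
    [k]. Positivity of each consecutive gap allows its denominator to be cleared. *)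
Lemma freq_separation (j k : 'I_K) t : (j < k)%N ->
  2 * alpha / sigma t <= derive1 (phi k) t - derive1 (phi j) t.
Proof.
have step (i l : 'I_K) : l = i.+1 :> nat ->
    2 * alpha / sigma t <= derive1 (phi l) t - derive1 (phi i) t.
  move=> il; have d0 : 0 < derive1 (phi l) t - derive1 (phi i) t.
    rewrite -lte_fin; apply: lt_le_trans (freq_sep x_class il) _.
    by apply: ge_ereal_inf; exists ((derive1 (phi l) t - derive1 (phi i) t)%:E) => //; exists t.
  have := width_sep sigma_width t il.
  by rewrite ler_pdivrMr// ler_pdivrMr// [leRHS]mulrC.
have a0 : 0 <= 2 * alpha / sigma t.
  by rewrite divr_ge0 ?mulr_ge0 ?(ltW (window_alpha_gt0 g_window)) ?(ltW (s0 t)).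
case: k => k kK /=; elim: k kK => // k IH kK; rewrite ltnS leq_eqVlt => /predU1P[jk|jk].
  by apply: step => /=; rewrite jk.
have kK' : (k < K)%N by exact: ltnW.
have := IH kK' jk; have := step (Ordinal kK') (Ordinal kK) erefl; lra.
Qed.

Lemma freq_separation_abs (k l : 'I_K) t : l != k ->
  2 * alpha / sigma t <= `|derive1 (phi l) t - derive1 (phi k) t|.
Proof.
rewrite neq_ltn => /orP[|] lk; have := freq_separation t lk => h.
  by rewrite distrC (le_trans h)// ler_norm.
by rewrite (le_trans h)// ler_norm.
Qed.

Lemma fourier_window_le xi : alpha <= `|xi| -> cmod (fourier g xi) <= tau0.
Proof.
move=> axi; rewrite -(window_alpha g_window).
have -> : cmod (fourier g xi) = cmod (fourier g `|xi|).
  have [x0|x0] := leP 0 xi; first by rewrite ger0_norm.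
  by rewrite ltr0_norm//; exact/esym/(window_even g_window).
apply: (window_decr g_window) => //; exact/ltW/(window_alpha_gt0 g_window).
Qed.

(** By contraposition: off all zones [sigma |eta - phi_k'| >= alpha], so the main term of index [k]
    is at most [tau0 A_k]. *)
Lemma zone_cover t eta te1 :
  sigma t * Lambda A eps1 eps2 sigma g t + tau0 * \sum_(k < K) A k t <= te1 ->
  te1 < cmod (V t eta) -> exists k, zone phi alpha sigma k (t, eta).
Proof.
move=> te1_ge; apply: contraPP => /forallNP nz; apply/negP; rewrite -leNgt.
apply: le_trans te1_ge; rewrite (stft_decomposition x_class (s0 t) eta rg).
rewrite addrC; apply: le_trans (cmodD _ _) _; apply: lerD.
  exact: (cmod_remainder x_class (s0 t)).
apply: le_trans (cmod_sum _ _ _) _; rewrite mulr_sumr; apply: ler_sum => k _.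
rewrite cmodM (cmod_component x_class) mulrC ler_wpM2r ?(amp_ge0 x_class)//.
apply: fourier_window_le; have /negP := nz k; rewrite /zone /= -leNgt => h.
by rewrite normrM gtr0_norm// mulrC -ler_pdivrMr.
Qed.

Lemma signal_continuous : ccont x.
Proof.
rewrite (_ : x = fun t => \sum_(k < K) component A phi k t)//.
elim: (index_enum _) => [|k s IH].
  rewrite (_ : (fun t => _) = fun=> 0); first exact: ccont_cst.
  by apply/funext => t; rewrite big_nil.
rewrite (_ : (fun t => _) = (fun t => component A phi k t + \sum_(j <- s) component A phi j t)).
  by apply: ccontD => //; exact: (component_continuous x_class).
by apply/funext => t; rewrite big_cons.
Qed.

Lemma signal_growth r : cmod (x r) <= (\sum_(k < K) (A k 0 + eps1)) * oneDsqr r.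
Proof.
apply: le_trans (cmod_sum _ _ _) _; rewrite mulr_suml; apply: ler_sum => k _.
by have := cmod_component_le x_class eps1_gt0 k 0 r; rewrite add0r.
Qed.

(** The two correction terms in the phase transformation are made to cancel the two contributions of
    [sigma'] to the time derivative. *)
Lemma phase_transform_cE t eta : V t eta != 0 ->
  phase_transform_c x sigma g t eta =
  eta%:C%C - stft x sigma (cderive g) t eta / (i2pi R * (sigma t)%:C%C * V t eta).
Proof.
move=> V0; have [ds cds] := width_C1 sigma_width.
have ds' s : derivable sigma s 1 by exact: (ds 0%N).
have := stft_time_derivative eta signal_continuous signal_growth s0 t sg ds' cds.
move=> /has_cderiveE D; rewrite /phase_transform_c D.
have sn : (sigma t)%:C%C != 0 :> R[i].
  by rewrite -cmod_gt0 cmodr gtr0_norm.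
have i0 := i2pi_neq0 R.
have -> : ((derive1 sigma t / sigma t)%:C)%C = (derive1 sigma t)%:C%C / (sigma t)%:C%C :> R[i].
  by rewrite rmorphM fmorphV.
rewrite fmorphV; field.
by rewrite V0 sn i0.
Qed.

Definition phase_residual k t eta : R[i] :=
  i2pi R * (eta - derive1 (phi k) t)%:C%C * remainder A phi sigma g t eta
  - remainder A phi sigma (cderive g) t eta / (sigma t)%:C%C
  + i2pi R * \sum_(l < K | l != k)
      component A phi l t
      * (derive1 (phi l) t - derive1 (phi k) t)%:C%C
      * fourier g (sigma t * (eta - derive1 (phi l) t)).

Lemma phase_transform_error k t eta : V t eta != 0 ->
  phase_transform_c x sigma g t eta - (derive1 (phi k) t)%:C%C =
  phase_residual k t eta / (i2pi R * V t eta).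
Proof.
move=> V0; rewrite phase_transform_cE//.
have sn : (sigma t)%:C%C != 0 :> R[i].
  by rewrite -cmod_gt0 cmodr gtr0_norm.
have i0 := i2pi_neq0 R.
(* Clearing the denominators in [phase_transform_cE] leaves this identity to be shown. *)
suff -> : phase_residual k t eta = i2pi R * (eta - derive1 (phi k) t)%:C%C * V t eta
    - stft x sigma (cderive g) t eta / (sigma t)%:C%C.
  by rewrite rmorphB; field; rewrite V0 sn i0.
rewrite (stft_decomposition x_class (s0 t) eta rg).
rewrite (stft_decomposition x_class (s0 t) eta rdg).
pose c l := component A phi l t; pose h l := fourier g (sigma t * (eta - derive1 (phi l) t)).
(* The transform of [g'] brings out [2 i pi sigma (eta - phi_l')], whose [sigma] cancels the
   [1 / sigma] in front of [V^{g'}]. *)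
have -> : \sum_(l < K) component A phi l t * fourier (cderive g) (sigma t * (eta - derive1 (phi l) t)) =
    (sigma t)%:C%C * \sum_(l < K) i2pi R * (eta - derive1 (phi l) t)%:C%C * (c l * h l).
  rewrite mulr_sumr; apply: eq_bigr => l _.
  rewrite (fourier_cderive _ rg rdg); last by move=> s; exact: (schwartz_derivable 0).
  by rewrite rmorphM /c /h; ring.
have T : i2pi R * \sum_(l < K | l != k) c l * (derive1 (phi l) t - derive1 (phi k) t)%:C%C * h l =
    i2pi R * (eta - derive1 (phi k) t)%:C%C * \sum_(l < K) c l * h l -
    \sum_(l < K) i2pi R * (eta - derive1 (phi l) t)%:C%C * (c l * h l).
  have := sum_recenter (i2pi R) eta%:C%C c h (fun l => (derive1 (phi l) t)%:C%C) k.
  under eq_bigr do rewrite -rmorphB.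
  rewrite -rmorphB => ->; congr (_ - _).
  by apply: eq_bigr => l _; rewrite rmorphB.
rewrite /phase_residual T -/c; field.
exact: sn.
Qed.

Lemma moment_ge0 n (f : R -> R[i]) : 0 <= moment n f.
Proof. by apply: Rintegral_ge0 => u _; exact: cmod_ge0. Qed.

(** On [[d / 4, d / 2]], with [d] small, [|f|] is at least [|f 0| / 2] by continuity, and the weight
    [|u|] at least [d / 4]: the interval has to avoid 0, where the weight vanishes. *)
Lemma moment1_gt0 (f : R -> R[i]) : rapid f -> f 0 != 0 -> 0 < moment 1 f.
Proof.
move=> rf f0; have [cf _] := rf.
have cm := continuous_cmod cf.
have c0 : 0 < cmod (f 0) / 2 by rewrite divr_gt0// cmod_gt0.
have [d /= d0 Hd] : \forall u \near 0, cmod (f 0) / 2 <= cmod (f u).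
  near=> u; have : `|cmod (f 0) - cmod (f u)| <= cmod (f 0) / 2.
    by near: u; apply: cvgr_dist_le => //; exact: cm.
  by rewrite ler_norml => /andP[_]; lra.
pose c := (d / 4) * (cmod (f 0) / 2).
have cpos : 0 < c by rewrite mulr_gt0// divr_gt0.
pose I : set R := `[d / 4, d / 2]%classic.
have mI : measurable I by exact: measurable_itv.
have II : intg (fun u => c * \1_I u).
  by apply: integrableZlr; exact: integrable_indic_itv.
apply: (@lt_le_trans _ _ (\int[mu]_u (c * \1_I u))).
  rewrite RintegralZl//; last exact: integrable_indic_itv.
  rewrite mulr_gt0// /Rintegral integral_indic// setIT /I /= lebesgue_measure_itv /= lte_fin.
  have -> : d / 4 < d / 2 by lra.
  by rewrite /= ; lra.
apply: le_Rintegral => //; first exact: rapid_moment.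
move=> u _; rewrite indicE; case: (boolP (u \in I)) => uI; last by rewrite mulr0 cmod_ge0.
rewrite mulr1 expr1 cmodM cmodr; move: uI; rewrite inE /I /= in_itv /= => /andP[u1 u2].
rewrite /c ler_pM ?divr_ge0 ?cmod_ge0 ?(ltW d0)//.
  by rewrite (le_trans u1)// ler_norm.
by apply: Hd; rewrite /ball /= sub0r normrN ger0_norm; lra.
Unshelve. all: by end_near. Qed.

Let Lambda_tail_ge0 (f : R -> R[i]) t :
  0 <= pi * eps2 * moment 2 f * sigma t * \sum_(k < K) A k t.
Proof.
have S0 : 0 <= \sum_(k < K) A k t by apply: sumr_ge0 => k _; exact: (amp_ge0 x_class).
have e2 := ltW eps2_gt0; have p0 := pi_ge0 R; have st := ltW (s0 t); have m2 := moment_ge0 2 f.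
by do !apply: mulr_ge0.
Qed.

Lemma Lambda_ge0 (f : R -> R[i]) t : 0 <= Lambda A eps1 eps2 sigma f t.
Proof.
apply: addr_ge0; last exact: Lambda_tail_ge0.
by have e1 := ltW eps1_gt0; have m1 := moment_ge0 1 f; do !apply: mulr_ge0.
Qed.

Lemma Lambda_gt0 t : (0 < K)%N -> 0 < Lambda A eps1 eps2 sigma g t.
Proof.
move=> K0; apply: ltr_pwDl; last exact: Lambda_tail_ge0.
apply: mulr_gt0; first by rewrite mulr_gt0// ltr0n.
exact: moment1_gt0 rg (window_neq0 g_window).
Qed.

(** The numerator is bounded by [2 pi N] without strictness; the strict inequality comes from
    [te1 < |V|] together with [0 < N], the latter thanks to [Lambda_gt0]. *)
Lemma phase_transform_bound k t eta te1 : (0 < K)%N -> 0 < te1 ->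
  te1 < cmod (V t eta) -> zone phi alpha sigma k (t, eta) ->
  `|phase_transform x sigma g t eta - derive1 (phi k) t| <
    bd1 A phi eps1 eps2 alpha sigma g t te1.
Proof.
move=> K0 te0 Vte; rewrite /zone /= => zk.
have V0 : V t eta != 0 by rewrite -cmod_gt0 (lt_trans te0).
have -> : phase_transform x sigma g t eta - derive1 (phi k) t =
    complex.Re (phase_transform_c x sigma g t eta - (derive1 (phi k) t)%:C%C).
  by rewrite ReD ReN.
apply: le_lt_trans (Re_le_cmod _) _; rewrite phase_transform_error// cmodM cmodV cmodM cmod_i2pi.
have p0 : 0 < 2 * pi :> R by rewrite mulr_gt0// pi_gt0.
pose E l k := A l t * `|derive1 (phi l) t - derive1 (phi k) t|
      * sup [set cmod (fourier g
                   (u + sigma t * (derive1 (phi k) t - derive1 (phi l) t)))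
            | u in [set u : R | `|u| < alpha]].
pose mx := \big[Num.max/0]_(k < K) \sum_(l < K | l != k) E l k.
pose N := alpha * Lambda A eps1 eps2 sigma g t
            + (2 * pi)^-1 * Lambda A eps1 eps2 sigma (cderive g) t + mx.
have a0 := window_alpha_gt0 g_window.
have mx0 : 0 <= mx.
  exact: bigmax_ge_id.
have N0 : 0 < N.
  rewrite /N -addrA ltr_pwDl ?mulr_gt0 ?Lambda_gt0// addr_ge0//.
  by rewrite mulr_ge0 ?Lambda_ge0// invr_ge0 ltW.
suff H : cmod (phase_residual k t eta) <= 2 * pi * N.
  have pV : 0 < 2 * pi * cmod (V t eta) by apply: mulr_gt0 => //; exact: lt_trans Vte.
  rewrite /bd1 -mulrDr -/N ltr_pdivrMr//.
  apply: le_lt_trans H _; rewrite mulrCA ltr_pM2l//.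
  by rewrite -mulrA ltr_pdivlMl// mulrC ltr_pM2l.
have gi := rapid_integrable rg.
rewrite /phase_residual; apply: le_trans (cmodD _ _) _.
rewrite /N mulrDr; apply: lerD; last first.
  rewrite cmodM cmod_i2pi ler_wpM2l ?(ltW p0)//.
  apply: (@le_trans _ _ (\sum_(l < K | l != k) E l k)); last first.
    exact: (le_bigmax _ (fun k => \sum_(l < K | l != k) E l k)).
  apply: le_trans (cmod_sum _ _ _) _; apply: ler_sum => l lk.
  rewrite cmodM [cmod (component _ _ _ _ * _)]cmodM (cmod_component x_class) cmodr.
  rewrite ler_wpM2l ?mulr_ge0 ?(amp_ge0 x_class)//.
  (* The supremum is a true upper bound because [fourier g] is bounded by the [L^1] norm of [g]. The
     point used is [u = sigma (eta - phi_k')], of size below [alpha] inside the zone. *)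
  apply: ub_le_sup.
    exists (\int[mu]_u cmod (g u)) => _ [u _ <-]; exact: cmod_fourier_le.
  exists (sigma t * (eta - derive1 (phi k) t)).
    by rewrite /= normrM gtr0_norm// mulrC -ltr_pdivlMr.
  by congr (cmod (fourier g _)); ring.
apply: le_trans (cmodD _ _) _; rewrite cmodN mulrDr; apply: lerD.
  rewrite !cmodM cmod_i2pi cmodr -[leLHS]mulrA ler_wpM2l ?(ltW p0)//.
  (* The width [alpha / sigma] of the zone cancels the [sigma] in the bound [sigma Lambda] on the
     remainder. *)
  have -> : alpha * Lambda A eps1 eps2 sigma g t =
     alpha / sigma t * (sigma t * Lambda A eps1 eps2 sigma g t) by field; exact: lt0r_neq0.
  apply: ler_pM; [exact: normr_ge0|exact: cmod_ge0|exact: ltW|].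
  exact: (cmod_remainder x_class (s0 t)).
rewrite mulrA mulfV ?mul1r ?lt0r_neq0// cmodM cmodV cmodr gtr0_norm// ler_pdivrMr// mulrC.
exact: (cmod_remainder x_class (s0 t)).
Qed.

End PhaseTransform.

(** * Bounds on a compactly supported mollifier *)

Section CompactSupport.
Variable R : realType.
Implicit Types (h : R -> R[i]).

Lemma csupport_bounded h : compact (csupport h) ->
  exists2 H : R, 0 < H & forall u, H < `|u| -> h u = 0.
Proof.
move=> /compact_bounded/ex_strict_bound_gt0[H H0 hH].
exists H => // u Hu; apply/eqP/negPn/negP => hu.
have : csupport h u by apply: subset_closure.
by move=> /hH /=; rewrite ltNge (ltW Hu).
Qed.

Lemma csupport_max h : ccont h -> compact (csupport h) ->
  exists M : R, forall u, cmod (h u) <= M.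
Proof.
move=> ch /csupport_bounded[H H0 hH].
have HH : - H <= H by lra.
have [c _ hc] := EVT_max HH (continuous_subspaceT (continuous_cmod ch)).
exists (cmod (h c)) => u; have [uH|uH] := leP `|u| H.
  by apply: hc; rewrite in_itv /= -ler_norml.
by rewrite hH// cmod0 cmod_ge0.
Qed.

End CompactSupport.

(** * Limit of the reassigned integral, in abstract form *)

Section Reassignment.
Variable R : realType.
Local Notation Re := (@complex.Re R).
Local Notation Im := (@complex.Im R).
Local Notation mu := (@lebesgue_measure R).
Local Notation intg f := (mu.-integrable setT (EFin \o f)).
Local Notation "\cint f" := (cintegral setT f) (at level 10).

Lemma integrable_indic_bounded (D : set R) (M : R) : measurable D ->
  (forall x, D x -> `|x| <= M) -> intg (\1_D : R -> R).
Proof.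
move=> mD DM; apply: (integrable_dom _ _ (integrable_indic_itv (- M) M true false)).
  exact: measurable_indic.
move=> x; rewrite !indicE ger0_norm//; case: (boolP (x \in D)) => // /set_mem /DM xM.
by rewrite mem_set//= in_itv /= -ler_norml.
Qed.

Lemma indic_ge0 T (D : set T) u : 0 <= \1_D u :> R.
Proof. by rewrite indicE ler0n. Qed.

Lemma indic_le1 T (D : set T) u : \1_D u <= 1 :> R.
Proof. by rewrite indicE lern1 leq_b1. Qed.

Lemma open_ball_itv (c e : R) : [set xi : R | `|xi - c| < e] = `]c - e, c + e[%classic.
Proof. by apply/seteqP; split => x /=; rewrite in_itv /= ltr_distl. Qed.

Lemma measurable_indic_comp d (T : measurableType d) (D : set R) (m : T -> R) :
  measurable D -> measurable_fun setT m -> measurable_fun setT (fun u => \1_D (m u) : R).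
Proof.
by move=> mD mm; apply: (@measurableT_comp _ _ _ _ _ _ (\1_D : R -> R)) => //.
Qed.

Variables (V h : R -> R[i]) (w : R -> R) (S Z : set R) (CV M : R) (c e : R).
Hypothesis mV : cmeas V.
Hypothesis V_bounded : forall eta, cmod (V eta) <= CV.
Hypothesis mw : measurable_fun setT w.
Hypothesis mS : measurable S.
Hypothesis S_bounded : forall eta, S eta -> `|eta| <= M.
Hypothesis h_cont : ccont h.
Hypothesis h_supp : compact (csupport h).
Hypothesis h_int : \cint h = 1.
Hypothesis wZ : forall eta, S eta -> Z eta -> `|w eta - c| < e.
Hypothesis wNZ : forall eta, S eta -> ~ Z eta -> e < `|w eta - c|.

Local Notation J := [set xi : R | `|xi - c| < e].

Let mJ : measurable J. Proof. by rewrite open_ball_itv; exact: measurable_itv. Qed.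

Let iS : intg (\1_S : R -> R).
Proof. exact: integrable_indic_bounded mS S_bounded. Qed.

Let iJ : intg (\1_J : R -> R).
Proof. by rewrite open_ball_itv; exact: integrable_indic_itv. Qed.

Lemma support_integrable : cintegrable h.
Proof.
have [H H0 hH] := csupport_bounded h_supp; have [Hb hHb] := csupport_max h_cont h_supp.
have i := integrableZlr Hb (integrable_indic_itv (- H) H true false).
apply: cintegrable_dom (ccont_meas h_cont) _ i => u.
have Hb0 : 0 <= Hb by exact: le_trans (cmod_ge0 _) (hHb 0).
rewrite indicE; case: (boolP (u \in _)) => uH; first by rewrite mulr1.
rewrite mulr0 hH ?cmod0//; move: uH; rewrite notin_setE /= in_itv /= -ler_norml.
by move/negP; rewrite -ltNge.
Qed.

(** The weight that a frequency [eta] with [w eta = y] receives once the integral over [xi] is done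
    first. *)
Definition mollified (lambda y : R) : R[i] :=
  \cint (fun xi => (\1_J xi)%:C%C * ((lambda^-1)%:C%C * h ((xi - y) / lambda))).

(** Substituting [xi = lambda u + y] moves [lambda] into the indicator, so the [L^1] norm of [h]
    bounds the weight uniformly in [lambda]. *)
Lemma mollifiedE lambda y : 0 < lambda ->
  mollified lambda y = \cint (fun u => (\1_J (lambda * u + y))%:C%C * h u).
Proof.
move=> l0; have li : 0 < lambda^-1 by rewrite invr_gt0.
have mm : measurable_fun setT (fun u : R => lambda * u + y).
  by apply: measurable_funD => //; exact: measurable_funM.
have i : cintegrable (fun u => (\1_J (lambda * u + y))%:C%C * h u).
  apply: cintegrable_dom (integrable_cmod support_integrable).
    apply: cmeasM (ccont_meas h_cont); apply: cmeas_real.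
    exact: measurable_indic_comp.
  move=> u; rewrite cmodM cmodr ler_piMl ?cmod_ge0// ger0_norm ?indic_ge0// indic_le1.
have := cintegral_affine (- (y / lambda)) li i; rewrite invrK.
move=> /(congr1 (fun z => (lambda^-1)%:C%C * z)); rewrite mulrA -rmorphM mulVf ?lt0r_neq0// mul1r => <-.
rewrite -cintegralZl; last exact: (cintegrable_affine (- (y / lambda)) li i).
apply: eq_cintegral => xi _.
have -> : lambda * (lambda^-1 * xi - y / lambda) + y = xi by field; exact: lt0r_neq0.
have -> : lambda^-1 * xi - y / lambda = (xi - y) / lambda by ring.
by ring.
Qed.

Lemma cmod_mollified lambda y : 0 < lambda ->
  cmod (mollified lambda y) <= \int[mu]_u cmod (h u).
Proof.
move=> l0; rewrite mollifiedE//; apply: cmod_cintegral_le (integrable_cmod support_integrable).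
  apply: cmeasM (ccont_meas h_cont); apply: cmeas_real.
  apply: (measurable_indic_comp mJ).
  by apply: measurable_funD => //; exact: measurable_funM.
move=> u; rewrite cmodM cmodr ler_piMl ?cmod_ge0// ger0_norm ?indic_ge0// indic_le1.
Qed.

(** Continuity is wanted for composing with [w], which is only measurable. *)
Lemma mollified_continuous lambda : ccont (mollified lambda).
Proof.
have [Hb hHb] := csupport_max h_cont h_supp.
have i := integrableZlr (`|lambda^-1| * Hb) iJ.
apply: (ccont_under_integral _ _ i).
- move=> y; apply: cmeas_restrict => //; apply: cmeasM; first exact: cmeas_cst.
  apply: (cmeas_comp (ccont_meas h_cont)).
  by apply: measurable_funM => //; exact: measurable_funB.
- move=> xi; apply: ccontM; first exact: ccont_cst.
  apply: ccontM; first exact: ccont_cst.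
  apply: (ccont_comp h_cont) => y; apply: cvgM; last exact: cvg_cst.
  by apply: cvgB; [exact: cvg_cst|exact: cvg_id].
move=> y xi; rewrite !cmodM !cmodr [leRHS]mulrC ger0_norm ?indic_ge0//.
by rewrite ler_wpM2l ?indic_ge0// ler_wpM2l.
Qed.

(** With [h] supported in [[-H, H]], mass lies within [lambda H] of [y]. Once this is below the
    distance from [y] to the ends of [J], the weight is the full integral of [h]. [mollified_eq0] is
    the mirror case for [y] outside [J]. *)
Lemma mollified_eq1 lambda y H : 0 < lambda -> (forall u, H < `|u| -> h u = 0) ->
  lambda * H < e - `|y - c| -> mollified lambda y = 1.
Proof.
move=> l0 hH lH; rewrite mollifiedE// -h_int; apply: eq_cintegral => u _.
have [uH|uH] := leP `|u| H; last by rewrite hH// mulr0.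
rewrite indicE mem_set ?mul1r//=.
have -> : lambda * u + y - c = lambda * u + (y - c) by ring.
apply: le_lt_trans (ler_normD _ _) _; rewrite normrM (gtr0_norm l0).
have : lambda * `|u| <= lambda * H by rewrite ler_pM2l.
lra.
Qed.

Lemma mollified_eq0 lambda y H : 0 < lambda -> (forall u, H < `|u| -> h u = 0) ->
  lambda * H < `|y - c| - e -> mollified lambda y = 0.
Proof.
move=> l0 hH lH; rewrite mollifiedE// -[RHS]cintegral0; apply: eq_cintegral => u _.
have [uH|uH] := leP `|u| H; last by rewrite hH// mulr0.
rewrite indicE memNset ?mul0r//= => /=.
have -> : lambda * u + y - c = lambda * u + (y - c) by ring.
have h1 : lambda * `|u| <= lambda * H by rewrite ler_pM2l.
have := ler_normB (lambda * u + (y - c)) (lambda * u).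
rewrite [_ + (y - c)]addrC addrK normrM (gtr0_norm l0); lra.
Qed.

(** The integrated synchrosqueezing transform at a fixed time. In the application [V] is the
    short-time transform in [eta], [w] the phase transformation, [S] the set where [|V|] exceeds the
    threshold, and [c], [e] are [phi_k'(t)] and [te3]. *)
Definition reassigned (lambda : R) : R[i] := cintegral J (fun xi =>
  cintegral S (fun eta => V eta * (lambda^-1)%:C%C * h ((xi - w eta) / lambda))).

(** Fubini applies because both [J] and [S] are bounded: for fixed [lambda] the integrand is
    dominated by a constant times the product of their indicators. *)
Lemma reassignedE lambda : 0 < lambda ->
  reassigned lambda = \cint (fun eta => (\1_S eta)%:C%C * V eta * mollified lambda (w eta)).
Proof.
move=> l0; have [Hb hHb] := csupport_max h_cont h_supp.
have Hb0 : 0 <= Hb by exact: le_trans (cmod_ge0 _) (hHb 0).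
have CV0 : 0 <= CV by exact: le_trans (cmod_ge0 _) (V_bounded 0).
pose F (z : measurableTypeR R * measurableTypeR R) : R[i] :=
  (\1_S z.2)%:C%C * V z.2 * ((\1_J z.1)%:C%C * ((lambda^-1)%:C%C * h ((z.1 - w z.2) / lambda))).
have mF : cmeas F.
  apply: cmeasM.
    apply: cmeasM.
      apply: cmeas_real; apply: (measurable_indic_comp mS); exact: measurable_snd.
    apply: (cmeas_comp mV); exact: measurable_snd.
  apply: cmeasM.
    apply: cmeas_real; apply: (measurable_indic_comp mJ); exact: measurable_fst.
  apply: cmeasM; first exact: cmeas_cst.
  apply: (cmeas_comp (ccont_meas h_cont)); apply: measurable_funM; last exact: measurable_cst.
  apply: measurable_funB; first exact: measurable_fst.
  by apply: (measurableT_comp mw); exact: measurable_snd.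
have ind0 (D : set R) u : 0 <= \1_D u :> R := indic_ge0 D u.
have bF xi eta : cmod (F (xi, eta)) <= \1_J xi * ((CV * (lambda^-1 * Hb)) * \1_S eta).
  rewrite /F /= !cmodM !cmodr [`|\1_S _|]ger0_norm// [`|\1_J _|]ger0_norm//.
  rewrite gtr0_norm ?invr_gt0//.
  have -> : \1_J xi * (CV * (lambda^-1 * Hb) * \1_S eta) =
    \1_S eta * CV * (\1_J xi * (lambda^-1 * Hb)) by ring.
  have li : 0 <= lambda^-1 by rewrite invr_ge0 ltW.
  apply: ler_pM; rewrite ?mulr_ge0 ?cmod_ge0//; first by rewrite ler_wpM2l.
  by rewrite ler_wpM2l// ler_wpM2l.
have iF xi : cintegrable (fun eta => (\1_S eta)%:C%C * (V eta * (lambda^-1)%:C%C * h ((xi - w eta) / lambda))).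
  apply: (cintegrable_dom _ _ (integrableZlr (CV * (lambda^-1 * Hb)) iS)).
    apply: cmeas_restrict => //; apply: cmeasM; first by apply: cmeasM => //; exact: cmeas_cst.
    apply: (cmeas_comp (ccont_meas h_cont)).
    by apply: measurable_funM => //; exact: measurable_funB.
  move=> eta; rewrite !cmodM !cmodr ger0_norm// gtr0_norm ?invr_gt0// [leRHS]mulrC ler_wpM2l//.
  rewrite -mulrA; have li : 0 <= lambda^-1 by rewrite invr_ge0 ltW.
  by apply: ler_pM; rewrite ?mulr_ge0 ?cmod_ge0// ler_wpM2l.
have E := cintegral_Fubini mF bF iJ (integrableZlr _ iS).
rewrite /reassigned cintegral_mkcond.
transitivity (\cint (fun xi => \cint (fun eta => F (xi, eta)))).
  apply: eq_cintegral => xi _; rewrite cintegral_mkcond -cintegralZl; last exact: iF.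
  by apply: eq_cintegral => eta _; rewrite /F /=; ring.
rewrite E; apply: eq_cintegral => eta _; rewrite /F /= cintegralZl; first by [].
apply: (cintegrable_dom _ _ (integrableZlr (lambda^-1 * Hb) iJ)).
  apply: cmeas_restrict; first exact: mJ.
  apply: cmeasM; first exact: cmeas_cst.
  apply: (cmeas_comp (ccont_meas h_cont)); apply: measurable_funM; last exact: measurable_cst.
  by apply: measurable_funB; [exact: measurable_id|exact: measurable_cst].
move=> xi; rewrite cmodM [cmod (_ * h _)]cmodM !cmodr.
rewrite [`|\1_J _|]ger0_norm; last exact: ind0.
rewrite [`|lambda^-1|]gtr0_norm; last by rewrite invr_gt0.
rewrite [leRHS]mulrC; apply: ler_wpM2l; first exact: ind0.
by apply: ler_wpM2l; [rewrite invr_ge0 ltW|exact: hHb].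
Qed.

Lemma reassigned_cvg (l_ : nat -> R) : (forall n, 0 < l_ n) -> l_ n @[n --> \oo] --> 0 ->
  Re (reassigned (l_ n)) @[n --> \oo] --> Re (cintegral (S `&` Z) V) /\
  Im (reassigned (l_ n)) @[n --> \oo] --> Im (cintegral (S `&` Z) V).
Proof.
move=> l0 lc; have [H H0 hH] := csupport_bounded h_supp.
have CV0 : 0 <= CV by exact: le_trans (cmod_ge0 _) (V_bounded 0).
have lH d : 0 < d -> \forall n \near \oo, l_ n * H < d.
  move=> d0; have : \forall n \near \oo, l_ n < d / H.
    have dH : 0 < d / H by rewrite divr_gt0.
    by apply: (cvgr_lt 0 lc).
  by apply: filterS => n; rewrite ltr_pdivlMr.
(* Pointwise the integrand is eventually constant: the strict hypotheses [wZ] and [wNZ] keep [w eta]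
   at positive distance from the ends of [J]. *)
have ev eta : \forall n \near \oo,
   (\1_S eta)%:C%C * V eta * mollified (l_ n) (w eta) = (\1_(S `&` Z) eta)%:C%C * V eta.
  have [Se|nSe] := pselect (S eta); last first.
    by apply: nearW => n; rewrite indicE memNset// indicE memNset ?mul0r//; case.
  have [Ze|nZe] := pselect (Z eta).
    have := lH (e - `|w eta - c|); rewrite subr_gt0 => /(_ (wZ Se Ze)).
    apply: filterS => n ln; rewrite (mollified_eq1 (l0 n) hH ln) mulr1.
    by rewrite indicE mem_set// indicE mem_set.
  have := lH (`|w eta - c| - e); rewrite subr_gt0 => /(_ (wNZ Se nZe)).
  apply: filterS => n ln; rewrite (mollified_eq0 (l0 n) hH ln) mulr0.
  by rewrite indicE memNset ?mul0r//; case.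
(* Abstracting the sequence lets [reassignedE], which needs the positivity of each [l_ n], be used
   termwise under the limit. *)
suff : forall r : nat -> R[i],
    (forall n, r n = \cint (fun eta => (\1_S eta)%:C%C * V eta * mollified (l_ n) (w eta))) ->
    Re (r n) @[n --> \oo] --> Re (cintegral (S `&` Z) V) /\
    Im (r n) @[n --> \oo] --> Im (cintegral (S `&` Z) V).
  by apply=> n; rewrite reassignedE.
move=> _ /funext ->.
rewrite cintegral_mkcond.
apply: (cintegral_dominated_cvg (G := fun eta => CV * (\int[mu]_u cmod (h u)) * \1_S eta)).
- move=> n; apply: cmeasM; first exact: cmeas_restrict.
  exact: (cmeas_comp (ccont_meas (mollified_continuous (l_ n)))).
- by move=> eta; apply: cvg_near_cst; apply: filterS (ev eta) => n ->.
- by move=> eta; apply: cvg_near_cst; apply: filterS (ev eta) => n ->.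
- move=> n eta; rewrite !cmodM cmodr ger0_norm ?indic_ge0//.
  rewrite -mulrA [leRHS]mulrC ler_wpM2l ?indic_ge0//.
  by apply: ler_pM; rewrite ?cmod_ge0// cmod_mollified.
- exact: integrableZlr.
Qed.

End Reassignment.

(** * Complex limits from real and imaginary parts *)

Section ComplexLimit.
Variable R : realType.

Lemma complex_cvg (F : set_system R) {FF : Filter F} (f : R -> R[i]^o) (l : R[i]^o) :
  complex.Re (f a) @[a --> F] --> complex.Re l ->
  complex.Im (f a) @[a --> F] --> complex.Im l -> f a @[a --> F] --> l.
Proof.
(* In the order of [R[i]] a positive [e] is a positive real number; half of it is allotted to each
   part. *)
move=> f1 f2; apply/cvgrPdist_lt => e; rewrite ltcE => /andP[/eqP eI eR].
have {}eI : complex.Im e = 0 by [].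
have e2 : 0 < complex.Re e / 2 by rewrite divr_gt0.
have H1 : \forall a \near F, `|complex.Re l - complex.Re (f a)| < complex.Re e / 2.
  by move/cvgrPdist_lt : f1; exact.
have H2 : \forall a \near F, `|complex.Im l - complex.Im (f a)| < complex.Re e / 2.
  by move/cvgrPdist_lt : f2; exact.
apply: filterS2 H1 H2 => a h1 h2.
have -> : `|l - f a| = (cmod (l - f a))%:C%C by rewrite normc_def cmodE.
rewrite ltcE /= eI eqxx /=; apply: le_lt_trans (cmod_le_ReIm _) _.
by rewrite ReD ImD ReN ImN; lra.
Qed.

Lemma complex_cvgMl (F : set_system R) {FF : Filter F} (c : R[i]) (f : R -> R[i]) (l : R[i]) :
  complex.Re (f a) @[a --> F] --> complex.Re l ->
  complex.Im (f a) @[a --> F] --> complex.Im l ->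
  (c * f a : R[i]^o) @[a --> F] --> (c * l : R[i]^o).
Proof.
move=> f1 f2; apply: complex_cvg.
  under eq_fun do rewrite ReM; rewrite ReM.
  by apply: cvgB; (apply: cvgM; first exact: cvg_cst).
under eq_fun do rewrite ImM; rewrite ImM.
by apply: cvgD; (apply: cvgM; first exact: cvg_cst).
Qed.

End ComplexLimit.

(** * Recovery of a component: claim (c) *)

Section Recovery.
Variables (R : realType) (K : nat) (A phi : 'I_K -> R -> R) (eps1 eps2 : R).
Hypothesis K_gt0 : (0 < K)%N.
Hypothesis x_class : signal_class A phi eps1 eps2.
Hypothesis eps1_gt0 : 0 < eps1.
Hypothesis eps2_gt0 : 0 < eps2.
Variables (g : R -> R[i]) (tau0 alpha : R).
Hypothesis g_window : window g tau0 alpha.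
Variable sigma : R -> R.
Hypothesis sigma_width : window_width phi alpha sigma.
Local Notation mu := (@lebesgue_measure R).
Local Notation intg f := (mu.-integrable setT (EFin \o f)).
Local Notation "\cint f" := (cintegral setT f) (at level 10).
Local Notation x := (signal A phi).
Local Notation V := (stft x sigma g).
Implicit Types (k l : 'I_K) (eta : R).
Variables (t te1 : R).
Hypothesis te1_gt0 : 0 < te1.

Let sg := window_schwartz g_window.
Let rg : rapid g := schwartz_rapid 0 sg.
Let rdg : rapid (cderive g) := schwartz_rapid 1 sg.
Let s0 : 0 < sigma t := width_gt0 sigma_width t.
Let a0 := window_alpha_gt0 g_window.

(** At fixed [t] the short-time transform is the Fourier transform in [eta] of this function, hence
    continuous and bounded. Integrability is the kernel estimate at frequency 0, translated by
    [t]. *)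
Lemma stft_integrand_integrable (f : R -> R[i]) : rapid f ->
  cintegrable (fun tau => x (t + tau) * ((sigma t)^-1)%:C%C * f (tau / sigma t)).
Proof.
move=> rf; have := stft_kernel_integrable 0 (signal_continuous x_class)
  (signal_growth x_class eps1_gt0) (width_gt0 sigma_width) t rf.
move=> /(cintegrable_affine t ltr01).
rewrite (_ : (fun y => _) = (fun tau => x (t + tau) * ((sigma t)^-1)%:C%C * f (tau / sigma t)))//.
apply/funext => tau; rewrite /stft_kernel mul1r addrK (addrC tau) mulr0 mul0r oppr0 cis0 mulr1.
by rewrite mulrA.
Qed.

Lemma stft_freq_continuous (f : R -> R[i]) : rapid f -> ccont (stft x sigma f t).
Proof. by move=> rf; have := fourier_continuous (stft_integrand_integrable rf). Qed.

Lemma stft_freq_bounded (f : R -> R[i]) : rapid f ->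
  exists M : R, forall eta, cmod (stft x sigma f t eta) <= M.
Proof.
move=> rf; have H eta := cmod_fourier_le eta (stft_integrand_integrable rf).
by eexists => eta; exact: H.
Qed.

Definition ridge : set R := [set eta | te1 < cmod (V t eta)].
Local Notation S := ridge.

Lemma ridge_open : open S.
Proof.
have -> : S = (fun eta => cmod (V t eta)) @^-1` [set y | te1 < y] by [].
apply: open_comp; last exact: open_gt.
by move=> eta _; apply: continuous_cmod; exact: stft_freq_continuous.
Qed.

Lemma ridge_measurable : measurable S.
Proof. by apply: open_measurable; apply: ridge_open. Qed.

Lemma phase_transform_continuous : {in S, continuous (phase_transform x sigma g t)}.
Proof.
pose b eta : R[i] := i2pi R * (sigma t)%:C%C * V t eta.
pose d eta : R[i] := stft x sigma (cderive g) t eta.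
have cb : ccont b by apply: ccontM; [exact: ccont_cst|exact: stft_freq_continuous].
have cd : ccont d by exact: stft_freq_continuous.
have pE eta : V t eta != 0 ->
    phase_transform x sigma g t eta = eta - complex.Re (d eta / b eta).
  move=> V0; rewrite /phase_transform.
  rewrite (phase_transform_cE x_class eps1_gt0 g_window sigma_width V0).
  by rewrite ReD ReN.
move=> eta; rewrite inE => Se.
have SV y : S y -> V t y != 0 by move=> Sy; rewrite -cmod_gt0 (lt_trans te1_gt0).
have b0 : b eta != 0.
  have sn : (sigma t)%:C%C != 0 :> R[i] by rewrite -cmod_gt0 cmodr gtr0_norm.
  by rewrite /b !mulf_neq0 ?i2pi_neq0// SV.
have cp : y - complex.Re (d y / b y) @[y --> eta] --> eta - complex.Re (d eta / b eta).
  apply: cvgB; first exact: cvg_id.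
  exact: (continuous_Re_div cb cd b0).
rewrite /continuous_at pE; last exact: SV.
apply: cvg_trans cp; apply: near_eq_cvg.
have : nbhs eta S by apply: open_nbhs_nbhs; split => //; exact: ridge_open.
by apply: filterS => y /SV /pE.
Qed.

(** Extension by 0 outside the ridge, where [V] may vanish: it makes the phase measurable on the
    whole line, as the abstract limit demands. *)
Definition ridge_phase : R -> R := phase_transform x sigma g t \_ S.
Local Notation w := ridge_phase.

Lemma ridge_phase_measurable : measurable_fun setT w.
Proof.
apply/(measurable_restrictT _ ridge_measurable).
by apply: open_continuous_measurable_fun; [exact: ridge_open|exact: phase_transform_continuous].
Qed.

Lemma ridge_phaseE eta : S eta -> w eta = phase_transform x sigma g t eta.
Proof. by move=> Se; rewrite /ridge_phase patchE mem_set. Qed.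

Hypothesis te1_large :
  sigma t * Lambda A eps1 eps2 sigma g t + tau0 * \sum_(k < K) A k t <= te1.

(** By (a) the ridge lies in the union of [K] intervals of half-width [alpha / sigma t]; the sum of
    all [|phi_k'|] is a crude common bound for their centres. *)
Lemma ridge_bounded : exists M : R, forall eta, S eta -> `|eta| <= M.
Proof.
exists (alpha / sigma t + \sum_(k < K) `|derive1 (phi k) t|) => eta Se.
have [k] := zone_cover x_class g_window sigma_width te1_large Se; rewrite /zone /= => zk.
have h : `|derive1 (phi k) t| <= \sum_(k < K) `|derive1 (phi k) t|.
  by rewrite (bigD1 k)//= lerDl sumr_ge0.
have := ler_normD (eta - derive1 (phi k) t) (derive1 (phi k) t); rewrite subrK; lra.
Qed.

Local Notation B1 := (bd1 A phi eps1 eps2 alpha sigma g t te1).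
Hypothesis B1_small : B1 <= alpha / sigma t.
Variables (te3 : R) (k : 'I_K).
Hypothesis B1_te3 : B1 <= te3.
Hypothesis te3_small : te3 <= alpha / sigma t.
Local Notation fk := (derive1 (phi k) t).

Definition band : set R := [set eta | `|eta - fk| < alpha / sigma t].
Local Notation Z := band.

Lemma band_measurable : measurable Z.
Proof. by rewrite /band open_ball_itv; exact: measurable_itv. Qed.

Lemma ridge_phase_in eta : S eta -> Z eta -> `|w eta - fk| < te3.
Proof.
move=> Se Ze; rewrite ridge_phaseE//; apply: lt_le_trans B1_te3.
exact: (phase_transform_bound x_class eps1_gt0 eps2_gt0 g_window sigma_width).
Qed.

(** By (a) such an [eta] lies in another zone [l], so its phase is closer than
    [bd1 <= alpha / sigma] to [phi_l'], which is itself at least [2 alpha / sigma] away from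
    [phi_k']. More than [alpha / sigma >= te3] remains. *)
Lemma ridge_phase_out eta : S eta -> ~ Z eta -> te3 < `|w eta - fk|.
Proof.
move=> Se nZ; rewrite ridge_phaseE//.
have [l zl] := zone_cover x_class g_window sigma_width te1_large Se.
have lk : l != k by apply/eqP => lk; apply: nZ; move: zl; rewrite lk.
have := phase_transform_bound x_class eps1_gt0 eps2_gt0 g_window sigma_width K_gt0 te1_gt0 Se zl.
have := freq_separation_abs x_class g_window sigma_width t lk.
have -> : 2 * alpha / sigma t = alpha / sigma t + alpha / sigma t by ring.
set p := phase_transform _ _ _ _ _ => h1 h2.
have := ler_normB (p - derive1 (phi k) t) (p - derive1 (phi l) t).
have -> : p - derive1 (phi k) t - (p - derive1 (phi l) t) = derive1 (phi l) t - derive1 (phi k) t by ring.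
move=> /(le_trans h1); move: h2 B1_small te3_small.
set u := `|_|; set v := `|_|; set a := alpha / sigma t; set bb := bd1 _ _ _ _ _ _ _ _ _; lra.
Qed.

Lemma Rintegral_band : \int[mu]_eta \1_Z eta = 2 * alpha / sigma t.
Proof.
have r0 : 0 < alpha / sigma t by rewrite divr_gt0.
rewrite /band open_ball_itv /Rintegral integral_indic//= setIT lebesgue_measure_itv /= lte_fin.
have -> : fk - alpha / sigma t < fk + alpha / sigma t by lra.
rewrite /=; ring.
Qed.

Lemma integrable_band : intg (\1_Z : R -> R).
Proof. by rewrite /band open_ball_itv; exact: integrable_indic_itv. Qed.

Section SubBand.
Variables (D : set R) (f : R -> R[i]) (M : R).
Hypothesis mD : measurable D.
Hypothesis DZ : D `<=` Z.
Hypothesis mf : cmeas f.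
Hypothesis M_ge0 : 0 <= M.
Hypothesis fM : forall eta, D eta -> cmod (f eta) <= M.

Let subband_bound eta : cmod ((\1_D eta)%:C%C * f eta) <= M * \1_Z eta.
Proof.
rewrite cmodM cmodr ger0_norm ?indic_ge0//.
have [De|nDe] := pselect (D eta).
  by rewrite !indicE (mem_set De) mem_set ?mul1r ?mulr1 ?fM//; exact: DZ.
by rewrite [\1_D _]indicE memNset// mul0r mulr_ge0// indic_ge0.
Qed.

Lemma subband_integrable : cintegrable (fun eta => (\1_D eta)%:C%C * f eta).
Proof.
apply: cintegrable_dom (integrableZlr M integrable_band); last exact: subband_bound.
exact: cmeas_restrict.
Qed.

Lemma cmod_cintegral_subband : cmod (cintegral D f) <= M * (2 * alpha / sigma t).
Proof.
rewrite cintegral_mkcond -Rintegral_band -RintegralZl//; last exact: integrable_band.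
apply: cmod_cintegral_le; last exact: (integrableZlr M integrable_band).
  exact: cmeas_restrict.
exact: subband_bound.
Qed.

End SubBand.

Let gi := rapid_integrable rg.
Let ghc : ccont (fourier g) := fourier_continuous gi.
Let ghi := schwartz_fourier_integrable sg.

Let shift l : R := sigma t * (fk - derive1 (phi l) t).
Let inner_disc : set R := [set u | `|u| < alpha].

Let disc_itv : inner_disc = `]- alpha, alpha[%classic.
Proof. by apply/seteqP; split => u; rewrite /inner_disc /= in_itv /= ltr_norml. Qed.

Let mdisc : measurable inner_disc.
Proof. by rewrite disc_itv; exact: measurable_itv. Qed.

Let shifted_integrable (D : set R) d : measurable D ->
  cintegrable (fun u => (\1_D u)%:C%C * fourier g (u + d)).
Proof.
move=> mD; have i : cintegrable (fun u => fourier g (1 * u + d)).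
  exact: cintegrable_affine.
apply: cintegrable_dom (integrable_cmod i).
  apply: cmeas_restrict => //; apply: cmeas_comp (ccont_meas ghc) _.
  by apply: measurable_funD; [exact: measurable_id|exact: measurable_cst].
move=> u; rewrite mul1r cmodM cmodr ger0_norm ?indic_ge0//.
by rewrite ler_piMl ?cmod_ge0// indic_le1.
Qed.

Lemma cintegral_band_fourier l :
  cintegral Z (fun eta => fourier g (sigma t * (eta - derive1 (phi l) t))) =
  ((sigma t)^-1)%:C%C * cintegral inner_disc (fun u => fourier g (u + shift l)).
Proof.
have i := shifted_integrable (shift l) mdisc.
rewrite [in RHS]cintegral_mkcond -(cintegral_affine (- (sigma t * fk)) s0 i).
rewrite cintegral_mkcond; apply: eq_cintegral => eta _.
have -> : sigma t * eta - sigma t * fk = sigma t * (eta - fk) by ring.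
have -> : \1_inner_disc (sigma t * (eta - fk)) = \1_Z eta :> R.
  rewrite !indicE; congr (nat_of_bool _)%:R; apply/idP/idP; rewrite !inE /inner_disc /band /=.
    by rewrite normrM gtr0_norm// ltr_pdivlMr// mulrC.
  by rewrite normrM gtr0_norm// ltr_pdivlMr// mulrC.
by congr (_ * fourier g _); rewrite /shift; ring.
Qed.

(** The zone is open while [leakage] integrates over the closed interval; the end points are
    null. *)
Lemma disc_leakage l :
  cmod (cintegral inner_disc (fun u => fourier g (u + shift l))) = leakage phi alpha sigma g l k t.
Proof.
rewrite /leakage; congr cmod; rewrite -/(shift l) disc_itv.
have -> : [set u : R | `|u| <= alpha] = `[- alpha, alpha]%classic.
  by apply/seteqP; split => u /=; rewrite in_itv /= ler_norml.
have i : cintegrable (fun u => fourier g (u + shift l)).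
  have := cintegrable_affine (shift l) ltr01 ghi.
  by under eq_fun do rewrite mul1r.
have [i1 i2] := i.
have sub (f : R -> R) (I : interval R) : intg f -> mu.-integrable [set` I] (EFin \o f).
  by apply: integrableS => //; exact: measurable_itv.
rewrite /cintegral; congr (_ +i* _)%C.
  by rewrite -Rintegral_itv_bndo_bndc ?Rintegral_itv_obnd_cbnd//; exact: sub.
by rewrite -Rintegral_itv_bndo_bndc ?Rintegral_itv_obnd_cbnd//; exact: sub.
Qed.

(** Fourier inversion at 0 evaluates the integral over the whole line, which is then split at
    [|u| = alpha]. *)
Lemma disc_complement : cintegral inner_disc (fourier g) =
  g 0 - cintegral [set u : R | alpha <= `|u|] (fourier g).
Proof.
have mo : measurable [set u : R | alpha <= `|u|].
  have -> : [set u : R | alpha <= `|u|] = ~` inner_disc.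
    by apply/seteqP; split => u /=; rewrite /inner_disc /= leNgt => /negP.
  exact: measurableC.
have i1 := shifted_integrable 0 mdisc; have i2 := shifted_integrable 0 mo.
have inv : \cint (fourier g) = g 0.
  have [C C0 gC] := rapid_decay rg.
  apply: fourier_inversion0 => //; first by case: rg.
  exists C => u; apply: le_trans (gC u) _.
  by rewrite ler_pdivrMr ?oneDsqr_gt0// ler_peMr// oneDsqr_ge1.
have z (D : set R) : (fun u => (\1_D u)%:C%C * fourier g (u + 0)) = (fun u => (\1_D u)%:C%C * fourier g u).
  by apply/funext => u; rewrite addr0.
rewrite z in i1; rewrite z in i2.
apply: (canRL (addrK _)); rewrite -inv (cintegral_mkcond inner_disc).
rewrite (cintegral_mkcond [set u : R | alpha <= `|u|]).
rewrite -(cintegralD i1 i2); apply: eq_cintegral => u _.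
rewrite -mulrDl -rmorphD !indicE.
have [ua|ua] := ltP `|u| alpha.
  by rewrite mem_set// memNset ?addr0 ?mul1r//= leNgt ua.
by rewrite memNset ?mem_set ?add0r ?mul1r//= /inner_disc /= ltNge ua.
Qed.

Let rem0 eta : R[i] := remainder A phi sigma g t eta.

Let mV : cmeas (V t).
Proof. by apply: ccont_meas; exact: stft_freq_continuous. Qed.

Let mfourier l : cmeas (fun eta => fourier g (sigma t * (eta - derive1 (phi l) t))).
Proof.
apply: cmeas_comp (ccont_meas ghc) _; apply: measurable_funM; first exact: measurable_cst.
by apply: measurable_funB; [exact: measurable_id|exact: measurable_cst].
Qed.

(** Obtained as the difference of [V] and the main terms, which avoids the defining integrals. *)
Lemma remainder_measurable : cmeas rem0.
Proof.
rewrite (_ : rem0 = fun eta => V t eta + (-1) * \sum_(l < K) component A phi l t *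
    fourier g (sigma t * (eta - derive1 (phi l) t))); last first.
  apply/funext => eta; rewrite (stft_decomposition x_class s0 eta rg) mulN1r.
  by rewrite addrAC subrr add0r.
apply: (cmeasD mV); apply: cmeasM; first exact: cmeas_cst.
apply: cmeas_sum => l _; apply: cmeasM; first exact: cmeas_cst.
exact: mfourier.
Qed.

(** Integrate over the whole zone, where the main terms are explicit, and subtract the part of it
    where [|V| <= te1]. *)
Lemma ridge_band_decomposition : cintegral (S `&` Z) (V t) =
  \sum_(l < K) component A phi l t *
     (((sigma t)^-1)%:C%C * cintegral inner_disc (fun u => fourier g (u + shift l)))
  + cintegral Z rem0 - cintegral (Z `\` S) (V t).
Proof.
have mS := ridge_measurable; have mZ := band_measurable.
have [CV hCV] := stft_freq_bounded rg.
have CV0 : 0 <= CV by exact: le_trans (cmod_ge0 _) (hCV 0).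
have G0 : 0 <= \int[mu]_u cmod (g u) by apply: Rintegral_ge0 => u _; exact: cmod_ge0.
have L0 : 0 <= sigma t * Lambda A eps1 eps2 sigma g t.
  exact: le_trans (cmod_ge0 _) (cmod_remainder x_class s0 0 rg).
have iSZ : cintegrable (fun eta => (\1_(S `&` Z) eta)%:C%C * V t eta).
  by apply: (subband_integrable (measurableI _ _ mS mZ) _ mV CV0) => eta [].
have iZS : cintegrable (fun eta => (\1_(Z `\` S) eta)%:C%C * V t eta).
  by apply: (subband_integrable (measurableD mZ mS) _ mV CV0) => eta [].
have iF l : cintegrable (fun eta => (\1_Z eta)%:C%C * fourier g (sigma t * (eta - derive1 (phi l) t))).
  by apply: (subband_integrable mZ (@subset_refl _ Z) (mfourier l) G0) => eta _; exact: cmod_fourier_le.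
have iR : cintegrable (fun eta => (\1_Z eta)%:C%C * rem0 eta).
  apply: (subband_integrable mZ (@subset_refl _ Z) remainder_measurable L0) => eta _.
  exact: (cmod_remainder x_class s0 eta rg).
apply: (canRL (addrK _)).
rewrite (cintegral_mkcond (S `&` Z)) (cintegral_mkcond (Z `\` S)) -(cintegralD iSZ iZS).
under eq_bigr do rewrite -cintegral_band_fourier cintegral_mkcond -(cintegralZl _ (iF _)).
rewrite -cintegral_sum; last by move=> l _; exact: cintegrableZl.
rewrite (cintegral_mkcond Z rem0) -cintegralD//; last first.
  by apply: cintegrable_sum => l _; exact: cintegrableZl.
apply: eq_cintegral => eta _; rewrite -mulrDl -rmorphD.
have -> : \1_(S `&` Z) eta + \1_(Z `\` S) eta = \1_Z eta :> R.
  rewrite !indicE; have [Ze|nZe] := pselect (Z eta); last first.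
    by rewrite !memNset ?addr0//; move=> [].
  have [Se|nSe] := pselect (S eta).
    by rewrite (mem_set Ze) mem_set// memNset ?addr0//; move=> [].
  by rewrite (mem_set Ze) memNset ?mem_set ?add0r//; move=> [].
rewrite (stft_decomposition x_class s0 eta rg) mulrDr; congr (_ + _).
by rewrite mulr_sumr; apply: eq_bigr => l _; rewrite mulrCA.
Qed.

(** The zone has length [2 alpha / sigma], so after multiplication by [sigma] the remainder
    contributes [2 alpha sigma Lambda] and the part below the threshold [2 alpha te1]. The tail of
    [fourier g] and the leakage of the other components make up the rest of [bd2]. *)
Lemma recovery_error :
  cmod ((sigma t)%:C%C / g 0 * cintegral (S `&` Z) (V t) - component A phi k t)
    <= bd2 A phi eps1 eps2 alpha sigma g t te1 k.
Proof.
have mS := ridge_measurable; have mZ := band_measurable.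
have g0 := window_neq0 g_window.
have sn : (sigma t)%:C%C != 0 :> R[i] by rewrite -cmod_gt0 cmodr gtr0_norm.
set P := fun l => cintegral inner_disc (fun u => fourier g (u + shift l)).
set Q := cintegral [set u : R | alpha <= `|u|] (fourier g).
set E1 := cintegral (Z `\` S) (V t); set E0 := cintegral Z rem0.
have Pk : P k = g 0 - Q.
  rewrite -disc_complement; apply: eq_cintegral => u _.
  by rewrite /shift subrr mulr0 addr0.
(* Since [P k = g 0 - Q], the main term of index [k] reproduces the component up to the tail [Q],
   and only error terms are left. *)
have -> : (sigma t)%:C%C / g 0 * cintegral (S `&` Z) (V t) - component A phi k t =
   (g 0)^-1 * ((sigma t)%:C%C * E0 - (sigma t)%:C%C * E1 - component A phi k t * Q
     + \sum_(l < K | l != k) component A phi l t * P l).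
  rewrite ridge_band_decomposition -/E1 -/E0.
  have -> : \sum_(l < K) component A phi l t * (((sigma t)^-1)%:C%C *
      cintegral inner_disc (fun u => fourier g (u + shift l))) =
      (sigma t)%:C%C^-1 * (component A phi k t * P k +
        \sum_(l < K | l != k) component A phi l t * P l).
    transitivity ((sigma t)%:C%C^-1 * \sum_(l < K) component A phi l t * P l).
      by rewrite mulr_sumr; apply: eq_bigr => l _; rewrite mulrCA -fmorphV.
    by rewrite (bigD1 k).
  rewrite Pk {Pk}; move: (\sum_(_ < K | _) _) => T; move: (component _ _ _ _) E0 E1 Q => C E0 E1 Q.
  by field; rewrite g0 sn.
rewrite cmodM cmodV /bd2; apply: ler_wpM2l; first by rewrite invr_ge0 cmod_ge0.
have e0 : cmod E0 <= sigma t * Lambda A eps1 eps2 sigma g t * (2 * alpha / sigma t).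
  apply: cmod_cintegral_subband => //; first exact: remainder_measurable.
    exact: le_trans (cmod_ge0 _) (cmod_remainder x_class s0 0 rg).
  by move=> eta _; exact: (cmod_remainder x_class s0 eta rg).
have e1 : cmod E1 <= te1 * (2 * alpha / sigma t).
  apply: cmod_cintegral_subband => //; [exact: measurableD|exact: ltW|].
  by move=> eta [_ /negP]; rewrite -leNgt.
have m2 L : sigma t * (L * (2 * alpha / sigma t)) = 2 * alpha * L by field; exact: lt0r_neq0.
apply: le_trans (cmodD _ _) _; apply: lerD; last first.
  apply: le_trans (cmod_sum _ _ _) _; apply: ler_sum => l _.
  by rewrite cmodM (cmod_component x_class) disc_leakage.
apply: le_trans (cmodD _ _) _; rewrite cmodN; apply: lerD.
  apply: le_trans (cmodD _ _) _; rewrite cmodN mulrDr; apply: lerD.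
    by rewrite cmodM cmodr gtr0_norm// -m2; apply: ler_wpM2l => //; exact: ltW.
  by rewrite cmodM cmodr gtr0_norm// -m2; apply: ler_wpM2l => //; exact: ltW.
by rewrite cmodM (cmod_component x_class).
Qed.

Variable h : R -> R[i].
Hypothesis h_smooth : smooth h.
Hypothesis h_supp : compact (csupport h).
Hypothesis h_int : \cint h = 1.

Lemma fsst_reassigned lambda :
  cintegral [set xi : R | `|xi - fk| < te3] (fsst x sigma g h te1 lambda t) =
  reassigned (V t) h w S fk te3 lambda.
Proof.
apply: eq_cintegral => xi _; apply: eq_cintegral => eta Se.
by rewrite ridge_phaseE.
Qed.

Lemma fsst_cvg : let recovered (lambda : R) : R[i]^o := (sigma t)%:C%C / g 0
     * cintegral [set xi : R | `|xi - fk| < te3] (fsst x sigma g h te1 lambda t) in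
  recovered lambda @[lambda --> 0^'+] -->
  ((sigma t)%:C%C / g 0 * cintegral (S `&` Z) (V t) : R[i]^o).
Proof.
move=> /=; have [M SM] := ridge_bounded; have [CV VCV] := stft_freq_bounded rg.
have ch : ccont h by apply: cderivable_continuous => u; exact: (h_smooth 0).
have H := reassigned_cvg mV VCV ridge_phase_measurable ridge_measurable SM
  ch h_supp h_int ridge_phase_in ridge_phase_out.
have [r1 r2] : complex.Re (reassigned (V t) h w S fk te3 lambda) @[lambda --> 0^'+] -->
    complex.Re (cintegral (S `&` Z) (V t)) /\
    complex.Im (reassigned (V t) h w S fk te3 lambda) @[lambda --> 0^'+] -->
    complex.Im (cintegral (S `&` Z) (V t)).
  (* The abstract result is sequential, as dominated convergence is; a one-sided limit can be tested
     on sequences of positive numbers. *)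
  by split; apply/cvg_at_rightP => u [u0 uc]; have [] := H u u0 uc.
rewrite (_ : (fun lambda => _) = (fun lambda =>
  (sigma t)%:C%C / g 0 * reassigned (V t) h w S fk te3 lambda)); last first.
  by apply/funext => lambda; rewrite fsst_reassigned.
exact: complex_cvgMl r1 r2.
Qed.

End Recovery.

(** * Assembly of the claims (a), (b) and (c) *)

Unset Implicit Arguments.

Theorem theorem1 (R : realType) (K : nat) (K_gt0 : (0 < K)%N)
  (A phi : 'I_K -> R -> R) (eps1 eps2 : R)
  (eps1_gt0 : 0 < eps1) (eps2_gt0 : 0 < eps2)
  (x_class : signal_class A phi eps1 eps2)
  (g : R -> R[i]) (tau0 alpha : R) (g_window : window g tau0 alpha)
  (sigma : R -> R) (sigma_width : window_width phi alpha sigma)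
  (h : R -> R[i]) (h_smooth : smooth h) (h_supp : compact (csupport h))
  (h_int : cintegral setT h = 1)
  (t te1 : R) (te1_gt0 : 0 < te1) :
  let x := signal A phi in
  let V := stft x sigma g in
  let omega_c := phase_transform_c x sigma g in
  let omega := phase_transform x sigma g in
  let rem0 := remainder A phi sigma g in
  let rem0' := remainder A phi sigma (cderive g) in
  let Lambda0 := Lambda A eps1 eps2 sigma g in
  let bd1 := bd1 A phi eps1 eps2 alpha sigma g t te1 in
  let bd2 := bd2 A phi eps1 eps2 alpha sigma g t te1 in
  let te1_large := sigma t * Lambda0 t + tau0 * \sum_(k < K) A k t <= te1 in
  [/\ (* (a) *)
      te1_large ->
      forall eta : R, te1 < cmod (V t eta) ->
      exists k : 'I_K, zone phi alpha sigma k (t, eta),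
      (* (b) *)
      (forall (eta : R) (k : 'I_K), V t eta != 0 ->
        let Rem1 :=
          i2pi R * (eta - derive1 (phi k) t)%:C%C * rem0 t eta
          - rem0' t eta / (sigma t)%:C%C
          + i2pi R * \sum_(l < K | l != k)
              component A phi l t
              * (derive1 (phi l) t - derive1 (phi k) t)%:C%C
              * fourier g (sigma t * (eta - derive1 (phi l) t)) in
        omega_c t eta - (derive1 (phi k) t)%:C%C = Rem1 / (i2pi R * V t eta)),
      (forall (eta : R) (k : 'I_K),
        te1 < cmod (V t eta) -> zone phi alpha sigma k (t, eta) ->
        `|omega t eta - derive1 (phi k) t| < bd1)
    & (* (c) *)
      te1_large -> bd1 <= alpha / sigma t ->
      forall (te3 : R) (k : 'I_K), bd1 <= te3 -> te3 <= alpha / sigma t ->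
      let recovered (lambda : R) : R[i]^o :=
        (sigma t)%:C%C / g 0
        * cintegral [set xi : R | `|xi - derive1 (phi k) t| < te3]
            (fsst x sigma g h te1 lambda t) in
      cvg (recovered lambda @[lambda --> 0^'+]) /\
      cmod (lim (recovered lambda @[lambda --> 0^'+]) - component A phi k t)
        <= bd2 k].
Proof.
move=> x V omega_c omega rem0 rem0' Lambda0 bd1 bd2 te1_large; split.
- by move=> te1_ge eta; exact: (zone_cover x_class g_window sigma_width te1_ge).
- move=> eta k V0; exact: (phase_transform_error x_class eps1_gt0 g_window sigma_width k V0).
- move=> eta k Vte zk.
  exact: (phase_transform_bound x_class eps1_gt0 eps2_gt0 g_window sigma_width K_gt0 te1_gt0 Vte zk).
move=> te1_ge bd1_small te3 k bd1_te3 te3_small recovered.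
have C := fsst_cvg (k := k) K_gt0 x_class eps1_gt0 eps2_gt0 g_window sigma_width te1_gt0 te1_ge
  bd1_small bd1_te3 te3_small h_smooth h_supp h_int.
split; first by apply/cvg_ex; eexists; exact: C.
rewrite (cvg_lim (@norm_hausdorff _ _) C).
exact: (recovery_error x_class eps1_gt0 g_window sigma_width t te1_gt0 k).
Qed.
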